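(* Suppose Assumptions (A1), (A2), (A3) hold and $\delta\in(0,a_0)$, where $a_0=\frac{1-e^{-\omega}}{2\sigma}$. Then there exists a unique $\mu_\infty\in\mathcal{P}_1(\mathbb{R}^d)$ with $\Psi(\mu_\infty)=\mu_\infty$. Moreover, for every $\gamma\in\mathcal{P}_1(\mathbb{R}^d)$, $$\limsup_{n\to\infty}\frac1n\log\mathcal{W}_1(\Psi^n(\gamma),\mu_\infty)<0 .$$
   Context: Fix integers $d,m\ge1$, a real $d\times d$ matrix $A$ with operator norm $\|A\|=\sup_{x\neq0}|Ax|/|x|$, $\delta>0$, a Borel probability measure $\theta$ on $\mathbb{R}^m$ and a measurable $f:\mathbb{R}^d\times\mathcal{P}_1(\mathbb{R}^d)\times\mathbb{R}^m\to\mathbb{R}^d$. $\mathcal{P}_1(\mathbb{R}^d)$ is the set of Borel probability measures on $\mathbb{R}^d$ with finite first moment, with the Wasserstein-1 distance $\mathcal{W}_1(\mu,\nu)=\inf E|X-Y|$ over couplings. For $\mu\in\mathcal{P}_1(\mathbb{R}^d)$, $\Psi(\mu)$ is the law of $AX+\delta f(X,\mu,\epsilon)$ where $(X,\epsilon)$ has law $\mu\otimes\theta$ (under (A1),(A2), $\Psi$ maps $\mathcal{P}_1(\mathbb{R}^d)$ into itself); $\Psi^n$ is the $n$-fold composition. Assumption (A1): $\sigma:=\int D(z)\theta(dz)<\infty$, where $D(z):=\sup\frac{|f(x_1,\mu_1,z)-f(x_2,\mu_2,z)|}{|x_1-x_2|+\mathcal{W}_1(\mu_1,\mu_2)}$,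 supremum over $(x_1,\mu_1)\neq(x_2,\mu_2)$. Assumption (A2): $\int D_1(z)\theta(dz)<\infty$, where $D_1(z)=|f(0,\delta_0,z)|$. Assumption (A3): $\|A\|\le e^{-\omega}$ for some $\omega>0$. *)

(* Defs.v *)
From HB Require Import structures.
From mathcomp Require Import all_boot all_order all_algebra.
From mathcomp Require Import all_classical all_reals all_analysis.
From mathcomp Require Import measurable_realfun.
Set Implicit Arguments. Unset Strict Implicit. Unset Printing Implicit Defensive.
Import Order.TTheory GRing.Theory Num.Theory.
Import numFieldNormedType.Exports.
Local Open Scope classical_set_scope.
Local Open Scope ring_scope.

(* The Borel measurable space on R^n: sigma-algebra generated by the open sets
   (of the product topology, which is the Euclidean topology). *)
Definition Borel (R : realType) (n : nat) :=
  g_sigma_algebraType (open : set (set 'M[R]_(n,1))).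

Definition enorm (R : realType) (n : nat) (x : 'M[R]_(n,1)) : R :=
  Num.sqrt (\sum_(i < n) x i ord0 ^+ 2).

Definition opnorm (R : realType) (n : nat) (A : 'M[R]_n) : R :=
  sup [set enorm (A *m x) / enorm x | x in [set x : 'M[R]_(n,1) | x != 0]].

(* Measures are handled as set functions; only their values on measurable
   sets matter.  [meq mu nu]: mu and nu agree on every Borel set. *)
Definition meq (R : realType) (n : nat) (mu nu : set (Borel R n) -> \bar R) :=
  forall B, measurable B -> mu B = nu B.

Definition P1 (R : realType) (n : nat) (mu : set (Borel R n) -> \bar R) :=
  (exists P : probability (Borel R n) R, meq P mu) /\
  (\int[mu]_x (enorm (x : 'M[R]_(n,1)))%:E < +oo)%E.

Definition edist (R : realType) (n : nat) (x y : 'M[R]_(n,1)) : R :=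
  enorm (x - y).

Definition coupling (R : realType) (n : nat) (mu nu : set (Borel R n) -> \bar R)
  (pi : probability (Borel R n * Borel R n)%type R) :=
  forall B, measurable B -> pi (fst @^-1` B) = mu B /\ pi (snd @^-1` B) = nu B.

Definition W1 (R : realType) (n : nat) (mu nu : set (Borel R n) -> \bar R) : \bar R :=
  ereal_inf [set (\int[pi]_p (edist p.1 p.2)%:E)%E
            | pi in [set pi | coupling mu nu pi]].

Definition eratio (R : realType) (num : R) (den : \bar R) : \bar R :=
  if den == 0%E then (if num == 0 then 0%E else +oo%E)
  else if den == +oo%E then 0%E else (num / fine den)%:E.

Definition Dlip (R : realType) (d m : nat)
  (f : 'M[R]_(d,1) -> (set (Borel R d) -> \bar R) -> 'M[R]_(m,1) -> 'M[R]_(d,1))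
  (z : 'M[R]_(m,1)) : \bar R :=
  ereal_sup [set r | exists x1 mu1 x2 mu2, P1 mu1 /\ P1 mu2 /\
     r = eratio (edist (f x1 mu1 z) (f x2 mu2 z)) ((edist x1 x2)%:E + W1 mu1 mu2)%E].

(* Psi(mu) = law of A X + delta f(X, mu, eps), (X, eps) ~ mu (x) theta;
   the product measure is written out as in the library's product_measure1:
   (mu \x theta)(E) = \int[mu]_x theta (xsection E x). *)
Definition Psi (R : realType) (d m : nat) (A : 'M[R]_d) (delta : R)
  (f : 'M[R]_(d,1) -> (set (Borel R d) -> \bar R) -> 'M[R]_(m,1) -> 'M[R]_(d,1))
  (theta : set (Borel R m) -> \bar R)
  (mu : set (Borel R d) -> \bar R) : set (Borel R d) -> \bar R :=
  fun B => (\int[mu]_x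
     theta [set z : Borel R m | B (A *m (x : 'M[R]_(d,1)) + delta *: f x mu z)%R])%E.

(* Main.v *)
(* For a coupling of [mu] and [nu] independent of the noise, (A1) and (A3) make
   [Psi] a contraction of [W1] with ratio [opnorm A + 2 * delta * sigma < 1], which
   gives uniqueness and the exponential rate.  Completeness of the Wasserstein
   space and gluing of couplings are avoided in the existence proof: with
   [mu_n = Psi^n delta_0] and an i.i.d. sequence of noises, the noises are fed in
   reverse order, i.e. [Y_(n+1) w = step mu_n (Y_n (shift w)) (head w)].  Then [Y_n] has
   law [mu_n], its increments are summable in [L^1], and the law of its almost sure
   limit is the fixed point. *)

From Pilot Require Import Defs.
From HB Require Import structures.
From mathcomp Require Import all_boot all_order all_algebra.
From mathcomp Require Import all_classical all_reals all_analysis.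
From mathcomp Require Import measurable_realfun.
From mathcomp Require Import ring lra.
Set Implicit Arguments. Unset Strict Implicit. Unset Printing Implicit Defensive.
Import Order.TTheory GRing.Theory Num.Theory.
Import numFieldNormedType.Exports.
Local Open Scope classical_set_scope.
Local Open Scope ring_scope.

(* The analysis library has its own [edist]. *)
Local Notation edist := Pilot.Defs.edist.

(** * Euclidean norm *)

(** The factor 2 in the ratio is one [delta * sigma] for the displacement of the point and one for
    the change of law inside [f]; the second is absorbed because [W1] of two laws never exceeds the
    cost of a coupling of them. Reversing the noises turns convergence in law into almost sure
    convergence: [Y_(n+2)] and [Y_(n+1)] apply the same outermost noise to a shifted copy of the
    pair [Y_(n+1)], [Y_n], so their expected distance shrinks by the ratio, whereas iterates fed
    forward would keep moving with each new noise. The i.i.d. noises are carried by one uniform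
    variable on the line through iterates of a single measurable map, which requires packing a point
    of R x R^m into one real number. Without gluing there is no triangle inequality for [W1]; that
    [mu_(n+1)] is close to both the limit law and its image under [Psi] is therefore exploited on
    closed sets, where each closeness costs a small thickening and a small additive error, and these
    compose. Since [Psi mu] is a bare set function, laws are compared on Borel sets and integrals
    are moved to genuine probabilities. *)

Lemma cauchy_schwarz_sum (R : realFieldType) (I : finType) (a b : I -> R) :
  (\sum_i a i * b i) ^+ 2 <= (\sum_i a i ^+ 2) * (\sum_i b i ^+ 2).
Proof.
set B := \sum_i b i ^+ 2; set C := \sum_i a i * b i; set D := \sum_i a i ^+ 2.
have B0 : 0 <= B by apply: sumr_ge0 => i _; exact: sqr_ge0.
(* This vector is [B] times the component of [a] orthogonal to [b]; when [B] is 0, [b] vanishes and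
   the claim is trivial. *)
have : 0 <= \sum_i (B * a i - C * b i) ^+ 2 by apply: sumr_ge0 => i _; exact: sqr_ge0.
have -> : \sum_i (B * a i - C * b i) ^+ 2 = B * (B * D - C ^+ 2).
  transitivity (\sum_i (B ^+ 2 * a i ^+ 2 + (- (2 * B * C)) * (a i * b i)
      + C ^+ 2 * b i ^+ 2)).
    by apply: eq_bigr => i _; ring.
  by rewrite 2!big_split/= -!mulr_sumr -/B -/C -/D; ring.
move: B0; rewrite le_eqVlt => /predU1P[B0 _|B0].
  have b0 i : b i = 0.
    apply/eqP; rewrite -sqrf_eq0; move/esym/eqP: B0.
    by rewrite psumr_eq0 => [/allP/(_ i (mem_index_enum _))//|j _]; exact: sqr_ge0.
  rewrite -B0 mulr0 /C big1 ?expr0n//= => i _.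
  by rewrite b0 mulr0.
by rewrite pmulr_rge0// subr_ge0 mulrC.
Qed.

Section euclidean_norm.
Context {R : realType} {n : nat}.
Implicit Types x y z : 'M[R]_(n, 1).

Lemma enorm_ge0 x : 0 <= enorm x.
Proof. exact: sqrtr_ge0. Qed.

Lemma sqr_enorm x : enorm x ^+ 2 = \sum_i x i ord0 ^+ 2.
Proof. by rewrite sqr_sqrtr// sumr_ge0// => i _; exact: sqr_ge0. Qed.

Lemma enormZ (c : R) x : enorm (c *: x) = `|c| * enorm x.
Proof.
apply/eqP; rewrite -(@eqrXn2 _ 2)// ?mulr_ge0 ?enorm_ge0//.
rewrite exprMn !sqr_enorm real_normK ?num_real// mulr_sumr; apply/eqP.
by apply: eq_bigr => i _; rewrite mxE exprMn.
Qed.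

Lemma enorm0 : enorm (0 : 'M[R]_(n, 1)) = 0.
Proof. by rewrite -(scale0r 0) enormZ normr0 mul0r. Qed.

Lemma enormN x : enorm (- x) = enorm x.
Proof. by rewrite -scaleN1r enormZ normrN1 mul1r. Qed.

Lemma ler_enormD x y : enorm (x + y) <= enorm x + enorm y.
Proof.
rewrite -(@ler_pXn2r _ 2)// ?nnegrE ?addr_ge0 ?enorm_ge0//.
rewrite sqrrD !sqr_enorm.
rewrite (_ : \sum_i _ = \sum_i x i ord0 ^+ 2 + 2 * (\sum_i x i ord0 * y i ord0)
  + \sum_i y i ord0 ^+ 2); last first.
  rewrite mulr_sumr -!big_split/=; apply: eq_bigr => i _; rewrite mxE; ring.
rewrite lerD2r lerD2l -[leRHS]mulr_natl ler_wpM2l//.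
rewrite (le_trans (ler_norm _))// -(@ler_pXn2r _ 2)// ?nnegrE ?mulr_ge0 ?enorm_ge0//.
rewrite real_normK ?num_real// exprMn !sqr_enorm.
exact: cauchy_schwarz_sum.
Qed.

Lemma ler_coord_enorm x i : `|x i ord0| <= enorm x.
Proof.
rewrite -(@ler_pXn2r _ 2)// ?nnegrE ?enorm_ge0// real_normK ?num_real// sqr_enorm.
rewrite (bigD1 i)//= lerDl sumr_ge0// => j _; exact: sqr_ge0.
Qed.

Lemma ler_enorm_sum x : enorm x <= \sum_i `|x i ord0|.
Proof.
rewrite -(@ler_pXn2r _ 2)// ?nnegrE ?enorm_ge0// ?sumr_ge0// sqr_enorm.
rewrite expr2 mulr_suml ler_sum// => i _.
rewrite -[leLHS]real_normK ?num_real// expr2 ler_wpM2l//.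
by rewrite (bigD1 i)//= lerDl sumr_ge0.
Qed.

Lemma enorm_eq0 x : (enorm x == 0) = (x == 0).
Proof.
apply/idP/idP => [/eqP x0|/eqP ->]; last by rewrite enorm0.
apply/eqP/matrixP => i j; rewrite ord1 mxE; apply/eqP.
by rewrite -normr_le0 -x0 ler_coord_enorm.
Qed.

Lemma edist_ge0 x y : 0 <= edist x y.
Proof. exact: enorm_ge0. Qed.

Lemma edistxx x : edist x x = 0.
Proof. by rewrite /edist subrr enorm0. Qed.

Lemma edistC x y : edist x y = edist y x.
Proof. by rewrite /edist -enormN opprB. Qed.

Lemma ler_edistD z x y : edist x y <= edist x z + edist z y.
Proof.
by rewrite /edist (le_trans _ (ler_enormD _ _))// addrA subrK.
Qed.

Lemma edistx0 x : edist x 0 = enorm x.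
Proof. by rewrite /edist subr0. Qed.

Lemma ler_edist_enormD x y : edist x y <= enorm x + enorm y.
Proof. by rewrite (le_trans (ler_enormD _ _))// enormN. Qed.

Lemma ler_enorm_edist x y : enorm x <= edist x y + enorm y.
Proof. by rewrite -!edistx0 ler_edistD. Qed.

End euclidean_norm.

Lemma ler_enorm_mulmx (R : realType) (n : nat) (A : 'M[R]_n) (x : 'M[R]_(n, 1)) :
  enorm (A *m x) <= opnorm A * enorm x.
Proof.
(* This crude entrywise bound shows that the quotients are bounded above; otherwise [sup] would only
   be a default value. *)
have bnd y : enorm (A *m y) <= (\sum_i \sum_j `|A i j|) * enorm y.
  rewrite (le_trans (ler_enorm_sum _))// mulr_suml ler_sum// => i _.
  rewrite mxE (le_trans (ler_norm_sum _ _ _))// mulr_suml ler_sum// => j _.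
  by rewrite normrM ler_wpM2l// ler_coord_enorm.
have [->|x0] := eqVneq x 0; first by rewrite mulmx0 enorm0 mulr0.
have ex0 : 0 < enorm x by rewrite lt_def enorm_ge0 enorm_eq0 x0.
rewrite -ler_pdivrMr//; apply: ub_le_sup; last by exists x.
exists (\sum_i \sum_j `|A i j|) => _ [y /= y0 <-].
by rewrite ler_pdivrMr// lt_def enorm_ge0 enorm_eq0 y0.
Qed.

Lemma opnorm_ge0 (R : realType) (n : nat) (A : 'M[R]_n) : 0 <= opnorm A.
Proof.
have [[x x0]|nA] := pselect (exists x : 'M[R]_(n, 1), x != 0).
  have xp : 0 < enorm x by rewrite lt_def enorm_eq0 x0 enorm_ge0.
  by rewrite -(pmulr_lge0 _ xp) (le_trans (enorm_ge0 (A *m x)))// ler_enorm_mulmx.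
(* In dimension 0 there is no nonzero vector, and [sup] of the empty set is 0. *)
rewrite /opnorm (_ : [set _ | _ in _] = set0) ?sup0//.
by apply/seteqP; split => // _ [x /= x0 _]; apply: nA; exists x.
Qed.

(** * Borel sets of R^n *)

Lemma image_probability (d1 d2 : measure_display) (T1 : measurableType d1)
    (T2 : measurableType d2) (R : realType) (P : probability T1 R) (f : T1 -> T2) :
  measurable_fun setT f ->
  exists Q : probability T2 R, forall B, Q B = P (f @^-1` B).
Proof.
move=> mf; pose F : {mfun T1 >-> T2} := HB.pack f (isMeasurableFun.Build _ _ _ _ f mf).
pose F' : {RV P >-> T2} := F.
by exists (distribution P F').
Qed.

Lemma ge0_integral_image (d1 d2 : measure_display) (T1 : measurableType d1)
    (T2 : measurableType d2) (R : realType) (m1 : {measure set T1 -> \bar R})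
    (m2 : {measure set T2 -> \bar R}) (f : T1 -> T2) (g : T2 -> \bar R) :
  measurable_fun setT f -> (forall B, measurable B -> m2 B = m1 (f @^-1` B)) ->
  measurable_fun setT g -> (forall y, (0 <= g y)%E) ->
  (\int[m2]_y g y = \int[m1]_x g (f x))%E.
Proof.
move=> mf m12 mg g0.
pose F : {mfun T1 >-> T2} := HB.pack f (isMeasurableFun.Build _ _ _ _ f mf).
have := @ge0_integral_pushforward _ _ _ _ _ F mf m1 setT g measurableT mg (fun y _ => g0 y).
rewrite preimage_setT => <-.
by apply: eq_measure_integral => A mA _; rewrite m12.
Qed.

Lemma integral_cst_probability (d : measure_display) (T : measurableType d)
    (R : realType) (P : probability T R) (c : R) : (\int[P]_t c%:E = c%:E)%E.
Proof.
rewrite integral_cst// -[RHS]mule1; congr (_ * _)%E; exact: probability_setT.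
Qed.

Section borel_coordinates.
Context {R : realType} {n : nat}.

Lemma measurable_coord (i : 'I_n) :
  measurable_fun [set: Borel R n] (fun x : Borel R n => (x : 'M[R]_(n, 1)) i ord0).
Proof.
apply: (measurability (@RGenOInfty.G R)); first exact: RGenOInfty.measurableE.
move=> _ [_ [r ->] <-]; rewrite setTI.
apply: sub_sigma_algebra.
rewrite (_ : _ @^-1` _ = [set x : 'M[R]_(n, 1) | r < x i ord0]); last first.
  by apply/seteqP; split => x /=; rewrite in_itv/= andbT.
rewrite openE => x /= rx; apply/nbhs_ballP.
exists (x i ord0 - r); first by rewrite /= subr_gt0.
move=> y [_ /(_ i ord0)]; rewrite /ball/= => H.
by move: H; rewrite ltr_distlC => /andP[H _]; lra.
Qed.

(** An open set is the union of the open boxes with rational corners that it contains. There are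
    countably many of them, and the preimage of a box is a finite intersection of conditions on
    single coordinates. *)
Lemma measurable_fun_coordP (d : measure_display) (T : measurableType d)
    (f : T -> Borel R n) :
  (forall i, measurable_fun [set: T] (fun t => (f t : 'M[R]_(n, 1)) i ord0)) ->
  measurable_fun [set: T] f.
Proof.
move=> mf. have := @measurability _ _ T (Borel R n) setT f open erefl. apply.
move=> _ [U oU <-]; rewrite setTI.
pose box (ab : 'M[rat]_(n, 1) * 'M[rat]_(n, 1)) : set 'M[R]_(n, 1) :=
  [set x | forall i, ratr (ab.1 i ord0) < x i ord0 < ratr (ab.2 i ord0)].
pose F ab : set T := [set t | box ab (f t) /\ box ab `<=` U].
rewrite (_ : f @^-1` U = \bigcup_ab F ab).
  apply: countable_bigcupT_measurable; first exact: countableP.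
  move=> ab; have [abU|abU] := pselect (box ab `<=` U); last first.
    rewrite (_ : F ab = set0)//; apply/seteqP; split => // t [_ //].
  rewrite (_ : F ab = \bigcap_(i in [set: 'I_n])
      (fun t => (f t : 'M[R]_(n, 1)) i ord0) @^-1`
        `](ratr (ab.1 i ord0)), (ratr (ab.2 i ord0))[%classic).
    apply: fin_bigcap_measurable => //.
    by move=> i _; rewrite -[X in measurable X]setTI; apply: mf.
  apply/seteqP; split => [t [bt _] i _ /=|t ht]; first by rewrite in_itv/=; exact: bt.
  by split => // i; have := ht i I; rewrite /= in_itv.
apply/seteqP; split => [t /= Ut|t [ab _ [bt]]]; last exact.
move: oU; rewrite openE => /(_ _ Ut) /nbhs_ballP[e /= e0 eU].
have /choice[a ha] i : exists a, f t i ord0 - e < ratr a < f t i ord0.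
  have [|q] := @rat_in_itvoo R (f t i ord0 - e) (f t i ord0); first by lra.
  by rewrite in_itv/=; exists q.
have /choice[b hb] i : exists b, f t i ord0 < ratr b < f t i ord0 + e.
  have [|q] := @rat_in_itvoo R (f t i ord0) (f t i ord0 + e); first by lra.
  by rewrite in_itv/=; exists q.
exists (\matrix_(i, j) a i, \matrix_(i, j) b i) => //; split.
  by move=> i; rewrite /= !mxE; have /andP[_ ->] := ha i; have /andP[-> _] := hb i.
move=> x hx; apply: eU; split => // i j; rewrite ord1.
have := hx i; rewrite /= !mxE /ball/= ltr_distl.
have := ha i; have := hb i => /andP[_ h1] /andP[h2 _] /andP[h3 h4].
by apply/andP; split; lra.
Qed.

Lemma measurable_fun_coord (d : measure_display) (T : measurableType d)
    (f : T -> Borel R n) (i : 'I_n) : measurable_fun [set: T] f ->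
  measurable_fun [set: T] (fun t => (f t : 'M[R]_(n, 1)) i ord0).
Proof. by move=> mf; exact: (measurableT_comp (measurable_coord i) mf). Qed.

Lemma measurable_enorm (d : measure_display) (T : measurableType d)
    (f : T -> Borel R n) : measurable_fun [set: T] f ->
  measurable_fun [set: T] (fun t => enorm (f t : 'M[R]_(n, 1))).
Proof.
move=> mf; rewrite /enorm.
have msqrt : measurable_fun [set: R] (@Num.sqrt R).
  by apply: continuous_measurable_fun; exact: sqrt_continuous.
apply: (measurableT_comp msqrt); apply: measurable_sum => i.
by apply: measurable_funX; exact: measurable_fun_coord.
Qed.

Lemma measurable_add_mx (d : measure_display) (T : measurableType d)
    (f g : T -> Borel R n) : measurable_fun [set: T] f -> measurable_fun [set: T] g ->
  measurable_fun [set: T] (fun t => (f t : 'M[R]_(n, 1)) + g t : Borel R n).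
Proof.
move=> mf mg; apply: measurable_fun_coordP => i.
under eq_fun do rewrite mxE.
by apply: measurable_funD; exact: measurable_fun_coord.
Qed.

Lemma measurable_scale_mx (d : measure_display) (T : measurableType d)
    (c : R) (f : T -> Borel R n) : measurable_fun [set: T] f ->
  measurable_fun [set: T] (fun t => c *: (f t : 'M[R]_(n, 1)) : Borel R n).
Proof.
move=> mf; apply: measurable_fun_coordP => i.
under eq_fun do rewrite mxE.
by apply: measurable_funM => //; exact: measurable_fun_coord.
Qed.

Lemma measurable_mulmx (d : measure_display) (T : measurableType d)
    (A : 'M[R]_n) (f : T -> Borel R n) : measurable_fun [set: T] f ->
  measurable_fun [set: T] (fun t => A *m (f t : 'M[R]_(n, 1)) : Borel R n).
Proof.
move=> mf; apply: measurable_fun_coordP => i.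
under eq_fun do rewrite mxE.
apply: measurable_sum => j.
by apply: measurable_funM => //; exact: measurable_fun_coord.
Qed.

Lemma measurable_edist (d : measure_display) (T : measurableType d)
    (f g : T -> Borel R n) : measurable_fun [set: T] f -> measurable_fun [set: T] g ->
  measurable_fun [set: T] (fun t => edist (f t) (g t)).
Proof.
move=> mf mg; apply: measurable_enorm.
apply: measurable_add_mx => //.
under eq_fun do rewrite -scaleN1r.
exact: measurable_scale_mx.
Qed.

Lemma measurable_edistE (d : measure_display) (T : measurableType d)
    (f g : T -> Borel R n) : measurable_fun [set: T] f -> measurable_fun [set: T] g ->
  measurable_fun [set: T] (fun t => (edist (f t) (g t))%:E).
Proof. by move=> mf mg; apply/measurable_EFinP; exact: measurable_edist. Qed.

Lemma measurable_enormE (d : measure_display) (T : measurableType d)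
    (f : T -> Borel R n) : measurable_fun [set: T] f ->
  measurable_fun [set: T] (fun t => (enorm (f t : 'M[R]_(n, 1)))%:E).
Proof. by move=> mf; apply/measurable_EFinP; exact: measurable_enorm. Qed.

End borel_coordinates.

(** * Splitting a uniform variable *)

Section cut_sup.
Context {R : realType}.
Implicit Types (q : nat -> R) (c : nat -> bool).

(** The value [-oo] is neutral for the supremum, and [esups] at rank 0 ranges over the whole
    sequence, so measurability in [c] follows from that of countable suprema. *)
Definition cut_sup q c : \bar R := esups (fun n => if c n then (q n)%:E else -oo%E) 0.

Lemma cut_sup_ub {q c} n : c n -> ((q n)%:E <= cut_sup q c)%E.
Proof. by move=> cn; apply: ereal_sup_ubound; exists n => //=; rewrite cn. Qed.

Lemma cut_sup_le q c (y : \bar R) :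
  (forall n, c n -> ((q n)%:E <= y)%E) -> (cut_sup q c <= y)%E.
Proof.
move=> cy; apply: ge_ereal_sup => _ [n _ <-].
by case: ifPn => [/cy//|_]; rewrite leNye.
Qed.

Lemma measurable_cut_sup (d : measure_display) (T : measurableType d) q
    (c : T -> nat -> bool) :
  (forall n, measurable_fun [set: T] (c ^~ n)) ->
  measurable_fun [set: T] (fun t => cut_sup q (c t)).
Proof.
move=> mc; apply: measurable_fun_esups => n.
by apply: measurable_fun_ifT => //; exact: measurable_cst.
Qed.

End cut_sup.

(* Binary digits are summed in base 3: the tail after a digit 0 is then at most
   1/2 < 1, so the digits can be read off the sum. *)
Section ternary_expansion.
Context {R : realType}.
Implicit Types c : nat -> bool.

Definition eternary c : \bar R := (\sum_(0 <= k <oo) (3^-1 ^+ k * (c k)%:R)%:E)%E.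

Definition ternary c : R := fine (eternary c).

(** The comparison with 1 detects the leading digit, which is removed before rescaling: on
    expansions this is the shift of the digit sequence. *)
Definition ternary_shift (y : R) : R := 3 * (if 1 <= y then y - 1 else y).

Definition ternary_digit (n : nat) (y : R) : bool := 1 <= iter n ternary_shift y.

Let term_ge0 c k : (0 <= (3^-1 ^+ k * (c k)%:R : R)%:E)%E.
Proof. by rewrite lee_fin mulr_ge0// exprn_ge0// invr_ge0. Qed.

Lemma eternary_ge0 c : (0 <= eternary c)%E.
Proof. by apply: nneseries_ge0 => n _ _; exact: term_ge0. Qed.

Lemma eternary_le c : (eternary c <= (3 / 2)%:E)%E.
Proof.
apply: lime_le; first by apply: is_cvg_nneseries => n _ _; exact: term_ge0.
apply: nearW => n; rewrite sumEFin lee_fin.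
(* The right-hand side is the geometric partial sum obtained when every digit is 1. *)
suff : \sum_(0 <= k < n) (3^-1 ^+ k * (c k)%:R) <= 3 / 2 * (1 - 3^-1 ^+ n) :> R.
  move=> /le_trans; apply; rewrite ler_piMr// gerBl exprn_ge0// invr_ge0//.
elim: n => [|n ih]; first by rewrite big_geq// expr0 subrr mulr0.
rewrite big_nat_recr//= exprS.
have : 3^-1 ^+ n * (c n)%:R <= 3^-1 ^+ n :> R.
  by rewrite ler_piMr ?exprn_ge0// lern1 leq_b1.
have : (0 : R) <= 3^-1 ^+ n by rewrite exprn_ge0.
by move: ih; set x := (3^-1 ^+ n : R) => ih x0; lra.
Qed.

Lemma eternary_fin c : eternary c \is a fin_num.
Proof.
by rewrite ge0_fin_numE ?eternary_ge0// (le_lt_trans (eternary_le c))// ltry.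
Qed.

Lemma ternary_bounds c : 0 <= ternary c <= 3 / 2.
Proof. by rewrite -!lee_fin fineK ?eternary_fin// eternary_ge0 eternary_le. Qed.

Lemma ternaryS c : ternary c = (c 0%N)%:R + 3^-1 * ternary (c \o S).
Proof.
apply: EFin_inj; rewrite EFinD EFinM !fineK ?eternary_fin// /eternary.
rewrite nneseries_recl// expr0 mul1r; congr (_ + _)%E.
rewrite -nneseriesZl; last by move=> k _; exact: (term_ge0 (c \o S)).
rewrite -(@nneseries_addn _ _ 1%N); last exact: term_ge0.
by apply: eq_eseriesr => k _; rewrite addn1 exprS -mulrA EFinM.
Qed.

Lemma ternary_shiftE c : ternary_shift (ternary c) = ternary (c \o S).
Proof.
rewrite /ternary_shift (ternaryS c); have := ternary_bounds (c \o S).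
by case: (c 0%N); case: ifPn; rewrite -?ltNge /=; lra.
Qed.

Lemma ternary_digitE n c : ternary_digit n (ternary c) = c n.
Proof.
rewrite /ternary_digit; elim: n c => [|n ih] c /=.
  rewrite (ternaryS c); have := ternary_bounds (c \o S).
  by case: (c 0%N) => /= h; [apply/idP|apply/negbTE; rewrite -ltNge]; lra.
by rewrite -iterS iterSr ternary_shiftE ih.
Qed.

Lemma measurable_ternary_shift : measurable_fun [set: R] ternary_shift.
Proof.
apply: measurable_funM => //; apply: measurable_fun_ifT => //.
  exact: measurable_fun_ler.
exact: measurable_funB.
Qed.

Lemma measurable_ternary_digit n : measurable_fun [set: R] (ternary_digit n).
Proof.
apply: measurable_fun_ler => //; elim: n => [|n ih] /=; first exact: measurable_id.
exact: (measurableT_comp measurable_ternary_shift ih).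
Qed.

Lemma measurable_ternary (d : measure_display) (T : measurableType d)
    (c : T -> nat -> bool) : (forall n, measurable_fun [set: T] (c ^~ n)) ->
  measurable_fun [set: T] (fun t => ternary (c t)).
Proof.
move=> mc.
have me : measurable_fun [set: T] (fun t => eternary (c t)).
  apply: ge0_emeasurable_sum => [k t _ _|k _]; first exact: term_ge0.
  apply/measurable_EFinP; apply: measurable_funM => //.
  have -> : (fun t => (c t k)%:R : R) = (fun t => if c t k then 1 else 0).
    by apply/funext => t; case: (c t k).
  by apply: measurable_fun_ifT.
by apply: (measurableT_comp _ me); exact: fine_measurable.
Qed.

End ternary_expansion.

Lemma cut_supE (R : realType) (q : nat -> R) (c : nat -> bool) (x : R) :
  (forall n, c n -> q n <= x) -> (forall r, r < x -> exists2 n, c n & r < q n) ->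
  cut_sup q c = x%:E.
Proof.
move=> cx xc; apply/eqP; rewrite eq_le; apply/andP; split.
  by apply: cut_sup_le => n /cx; rewrite lee_fin.
apply/lee_addgt0Pr => e e0; have [|n cn qn] := xc (x - e); first by lra.
by rewrite -leeBlDr// (le_trans _ (cut_sup_ub cn))// -EFinB lee_fin ltW.
Qed.

(* A point is encoded by the Dedekind cuts of its coordinates, i.e. by countably
   many bits, themselves packed into a single real number. *)
Section borel_embedding.
Context {R : realType} {m : nat}.
Let X := (measurableTypeR R * Borel R m)%type.

Let xi (i : option 'I_m) (x : X) : R :=
  if i is Some i then (x.2 : 'M[R]_(m, 1)) i ord0 else x.1.

Let measurable_xi i : measurable_fun [set: X] (xi i).
Proof.
case: i => [i|]; last exact: measurable_fst.
exact: (measurable_fun_coord i measurable_snd).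
Qed.

(** There is one bit per coordinate and rational. The rationals whose bit is set accumulate at the
    coordinate from below, which is recovered as their supremum. *)
Let cut (x : X) (n : nat) : bool :=
  if unpickle n is Some (i, q) then ratr q < xi i x else false.

Let measurable_cut n : measurable_fun [set: X] (cut ^~ n).
Proof.
rewrite /cut; case: (unpickle n) => [[i q]|] //.
by apply: measurable_fun_ltr => //; exact: measurable_cst.
Qed.

Let ratn (n : nat) : R :=
  if (unpickle n : option (option 'I_m * rat)%type) is Some (_, q) then ratr q else 0.

Let isn (i : option 'I_m) (n : nat) : bool :=
  if (unpickle n : option (option 'I_m * rat)%type) is Some (i', _) then i' == i else false.

Let dec (i : option 'I_m) (y : R) : R :=
  fine (cut_sup ratn (fun n => isn i n && ternary_digit n y)).

Let measurable_dec i : measurable_fun [set: R] (dec i).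
Proof.
have : measurable_fun [set: R] (fun y => cut_sup ratn (fun n => isn i n && ternary_digit n y)).
  apply: measurable_cut_sup => n; apply: measurable_and => //.
  exact: measurable_ternary_digit.
by apply: measurableT_comp; exact: fine_measurable.
Qed.

Let dec_ternary i x : dec i (ternary (cut x)) = xi i x.
Proof.
rewrite /dec (@cut_supE _ _ _ (xi i x))//.
  move=> n; rewrite ternary_digitE /isn /ratn /cut.
  by case: (unpickle n) => [[j q]|//] /andP[/eqP -> /ltW].
move=> r /rat_in_itvoo[q]; rewrite in_itv/= => /andP[rq qx].
exists (pickle (i, q)); rewrite ?ternary_digitE /isn /ratn /cut pickleK//.
by rewrite eqxx.
Qed.

(** A measurable left inverse suffices to reduce sampling to the line: a law is pushed to R by [j],
    sampled there, and brought back by [k]. *)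
Lemma borel_embedding : exists (j : X -> measurableTypeR R) (k : measurableTypeR R -> X),
  [/\ measurable_fun [set: X] j, measurable_fun [set: measurableTypeR R] k
    & forall x, k (j x) = x].
Proof.
exists (fun x => ternary (cut x)).
exists (fun y => (dec None y, \matrix_(i, j) dec (Some i) y)); split.
- by apply: measurable_ternary => n; exact: measurable_cut.
- apply/measurable_fun_pair; first exact: measurable_dec.
  apply: measurable_fun_coordP => i; under eq_fun do rewrite mxE.
  exact: measurable_dec.
- move=> [x y]; congr (_, _); first by rewrite dec_ternary.
  by apply/matrixP => i j; rewrite mxE dec_ternary ord1.
Qed.

End borel_embedding.

(** * Inverse transform sampling on the line *)

Section quantile.
Context {R : realType}.
Implicit Types P Q : probability (measurableTypeR R) R.

(** The complementary rays []x, +oo[] generate the Borel sets and are stable under intersection, so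
    uniqueness of measures applies. *)
Lemma probability_eq_ray P Q : (forall x : R, P `]-oo, x]%classic = Q `]-oo, x]%classic) ->
  forall B, measurable B -> P B = Q B.
Proof.
move=> PQ B mB.
apply: (@measure_unique _ R (measurableTypeR R) (@RGenOInfty.G R)
  (fun n => `](- n%:R)%R, +oo[%classic)) => //.
- exact: RGenOInfty.measurableE.
- move=> _ _ [x ->] [y ->]; exists (Num.max x y).
  apply/seteqP; split => z /=; rewrite !in_itv/= !andbT gt_max.
    by move=> [-> ->].
  by move=> /andP.
- by move=> n; exists (- n%:R).
- rewrite -subTset => x _; exists (Num.truncn (- x)).+1 => //=.
  by rewrite in_itv/= andbT ltrNl truncnS_gt.
- move=> _ [x ->]; have -> : `]x, +oo[%classic = ~` `]-oo, x]%classic.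
    by rewrite setCitvl.
  have SC (S : probability (measurableTypeR R) R) :
      S (~` `]-oo, x]%classic) = (1 - S `]-oo, x]%classic)%E by exact: probability_setC.
  by transitivity (1 - P `]-oo, x]%classic)%E; [exact: SC|rewrite PQ; exact/esym/SC].
- by move=> k; rewrite (le_lt_trans (probability_le1 _ _))// ltry.
Qed.

Variable Q : probability (measurableTypeR R) R.

Let F (x : R) : R := fine (Q `]-oo, x]%classic).

Let FE (x : R) : Q `]-oo, x]%classic = (F x)%:E.
Proof. by rewrite fineK// fin_num_measure. Qed.

Let F_nd : {homo F : x y / x <= y}.
Proof.
move=> x y xy; rewrite -lee_fin -!FE le_measure ?inE//.
exact: subset_itvl.
Qed.

(** Together with [F_large], this expresses the limits of [F] at the two infinities; for u strictly
    between 0 and 1 they make the supremum defining the quantile finite. *)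
Let F_small u : 0 < u -> exists q : rat, F (ratr q) < u.
Proof.
move=> u0.
have : Q `]-oo, (- n%:R : R)]%classic @[n --> \oo] --> Q (\bigcap_n `]-oo, (- n%:R : R)]%classic).
  apply: nonincreasing_cvg_mu => //.
  - by rewrite (le_lt_trans (probability_le1 _ _))// ltry.
  - by apply: bigcap_measurable => //; exists 0%N.
  - by move=> m n mn; apply/subsetPset/subset_itvl; rewrite bnd_simp lerN2 ler_nat.
rewrite (_ : \bigcap_n _ = set0); last first.
  rewrite -subset0 => t /(_ (Num.truncn (- t)).+1 I).
  by rewrite /= in_itv/= leNgt => /negP; apply; rewrite ltrNl truncnS_gt.
rewrite measure0; under eq_fun do rewrite FE.
move=> /fine_cvgP[_ /=] /cvgr_lt/(_ u u0)[N _ /(_ N (leqnn N))] /= FN.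
by exists (- N%:R); rewrite rmorphN/= ratr_nat.
Qed.

Let F_large u : u < 1 -> exists n, u < F n%:R.
Proof.
move=> u1.
have : Q `]-oo, (n%:R : R)]%classic @[n --> \oo] --> Q (\bigcup_n `]-oo, (n%:R : R)]%classic).
  apply: nondecreasing_cvg_mu => //; first exact: bigcup_measurable.
  by move=> m n mn; apply/subsetPset/subset_itvl; rewrite bnd_simp ler_nat.
rewrite (_ : \bigcup_n _ = setT); last first.
  rewrite -subTset => t _; exists (Num.truncn t).+1 => //=.
  by rewrite in_itv/= ltW// truncnS_gt.
rewrite probability_setT; under eq_fun do rewrite FE.
move=> /fine_cvgP[_ /=] /cvgr_gt/(_ u u1)[N _ /(_ N (leqnn N))] /= FN.
by exists N.
Qed.

(** This is right continuity of the distribution function, tested at rationals because the cuts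
    below only see rationals. *)
Let F_right u x : (forall q : rat, x < ratr q -> u <= F (ratr q)) -> u <= F x.
Proof.
move=> uF.
have : Q `]-oo, (x + n.+1%:R^-1 : R)]%classic @[n --> \oo] -->
    Q (\bigcap_n `]-oo, (x + n.+1%:R^-1 : R)]%classic).
  apply: nonincreasing_cvg_mu => //.
  - by rewrite (le_lt_trans (probability_le1 _ _))// ltry.
  - by apply: bigcap_measurable => //; exists 0%N.
  - move=> m n mn; apply/subsetPset/subset_itvl.
    by rewrite bnd_simp lerD2l lef_pV2 ?posrE// ler_nat.
rewrite -itvNycEbigcap FE; under eq_fun do rewrite FE.
move=> /fine_cvgP[_ /=] Fx; apply: (cvgr_to_ge Fx); apply: nearW => n /=.
have [|q] := @rat_in_itvoo R x (x + n.+1%:R^-1); first by rewrite ltrDl.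
rewrite in_itv/= => /andP[xq qn]; apply: (le_trans (uF _ xq)).
by apply: F_nd; exact: ltW.
Qed.

Let ratn (n : nat) : R := if unpickle n is Some q then ratr q else 0.

Let cut (u : R) (n : nat) : bool := (unpickle n != None :> option rat) && (F (ratn n) < u).

(** For u in []0, 1[] this is the quantile function, the least x with [u <= F x]. Writing it as a
    supremum over rationals makes it measurable. *)
Let phi (u : R) : R := fine (cut_sup ratn (cut u)).

Let measurable_phi : measurable_fun [set: R] phi.
Proof.
have : measurable_fun [set: R] (fun u => cut_sup ratn (cut u)).
  apply: measurable_cut_sup => n; apply: measurable_and => //.
  by apply: measurable_fun_ltr => //; exact: measurable_cst.
by apply: measurableT_comp; exact: fine_measurable.
Qed.

Let cut_pickle u (q : rat) : cut u (pickle q) = (F (ratr q) < u).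
Proof. by rewrite /cut /ratn pickleK. Qed.

(** The quantile and the distribution function form a Galois connection: right continuity gives one
    implication, monotonicity of [F] the other. *)
Let phi_le u x : 0 < u < 1 -> (phi u <= x) = (u <= F x).
Proof.
move=> /andP[u0 u1].
have Fcut n y : cut u n -> u <= F y -> ratn n <= y.
  move=> /andP[_ Fu] uF; rewrite leNgt; apply/negP => /ltW /F_nd yn.
  by have := le_lt_trans (le_trans uF yn) Fu; rewrite ltxx.
have [q qu] := F_small u0; have [N uN] := F_large u1.
have qS := @cut_sup_ub _ ratn (cut u) (pickle q).
rewrite cut_pickle in qS; have {qS} := qS qu.
have : (cut_sup ratn (cut u) <= N%:R%:E)%E.
  by apply: cut_sup_le => n cn; rewrite lee_fin (Fcut n)// ltW.
rewrite /phi; case E : (cut_sup ratn (cut u)) => [s| |]//= _ _.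
apply/idP/idP => [sx|uF].
  apply: F_right => r xr; rewrite leNgt; apply/negP => ru.
  have := @cut_sup_ub _ ratn (cut u) (pickle r); rewrite cut_pickle => /(_ ru).
  by rewrite E /ratn pickleK lee_fin => /le_trans/(_ sx); rewrite leNgt xr.
rewrite -lee_fin -E; apply: cut_sup_le => n cn.
by rewrite lee_fin (Fcut n).
Qed.

Lemma quantile_transform : exists2 g : measurableTypeR R -> measurableTypeR R,
  measurable_fun [set: measurableTypeR R] g &
  forall B, measurable B -> uniform_prob (@ltr01 R) (g @^-1` B) = Q B.
Proof.
exists phi => //.
have [U UE] := @image_probability _ _ (measurableTypeR R) (measurableTypeR R) R
  (uniform_prob (@ltr01 R)) phi measurable_phi.
move=> B mB; rewrite -(UE B).
apply: (@probability_eq_ray U Q _ B mB) => x.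
rewrite UE /= /uniform_prob integral_uniform_pdf.
pose A := phi @^-1` `]-oo, x]%classic `&` `[0, 1]%classic; rewrite -/A.
have mA : measurable A.
  by apply: measurableI => //; rewrite -[X in measurable X]setTI; exact: measurable_phi.
rewrite (eq_integral (cst 1%E)); last first.
  by move=> y; rewrite inE => -[_]; rewrite /uniform_pdf /= in_itv/= => ->; rewrite subr0 invr1.
rewrite integral_cst// mul1e FE.
have F01 : 0 <= F x <= 1.
  by rewrite -!lee_fin -FE measure_ge0 probability_le1.
(* [A] is squeezed between []0, F x[] and [[0, F x]] with the point 1 added, both of Lebesgue
   measure [F x]. The endpoints 0 and 1 are set apart because [phi_le] holds only strictly
   inside. *)
apply/eqP; rewrite eq_le; apply/andP; split.
  apply: (@le_trans _ _ (lebesgue_measure (`[0, F x]%classic `|` [set 1]))).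
    apply: le_measure; rewrite ?inE//; first exact: measurableU.
    move=> u [/=]; rewrite !in_itv/= => ux /andP[u0 u1].
    have [->|u1'] := eqVneq u 1; first by right.
    left; rewrite u0/=; move: u0; rewrite le_eqVlt => /predU1P[<-|u0].
      by case/andP: F01.
    by rewrite -phi_le// u0 lt_neqAle u1' u1.
  apply: (le_trans (measureU2 _ _ _)) => //.
  rewrite [X in (_ + X)%E]lebesgue_measure_set1 adde0.
  have <- : lebesgue_measure (`[0, F x]%classic : set R) = (F x)%:E; last exact: lexx.
  rewrite lebesgue_measure_itv/= lte_fin; case: ifPn; first by rewrite sube0.
  by rewrite -leNgt => F0; congr EFin; apply/eqP; rewrite eq_le F0 andbT; case/andP: F01.
apply: (@le_trans _ _ (lebesgue_measure (`]0, F x[%classic : set R))).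
  rewrite lebesgue_measure_itv/= lte_fin; case: ifPn; first by rewrite sube0.
  by rewrite -leNgt lee_fin.
apply: le_measure; rewrite ?inE//.
move=> u /=; rewrite !in_itv/= => /andP[u0 ux].
have u1 : u < 1 by case/andP: F01 => _; exact: lt_le_trans.
split; last by rewrite /= in_itv/= (ltW u0) (ltW u1).
by rewrite /= in_itv/= phi_le ?u0 ?u1// ltW.
Qed.

End quantile.

(* [g] splits one uniform variable into an independent pair with
   laws [theta] and uniform; iterating it yields an i.i.d. sequence of law
   [theta] without infinite product measures. *)
Lemma uniform_split (R : realType) (m : nat) (theta : probability (Borel R m) R) :
  exists g : measurableTypeR R -> (measurableTypeR R * Borel R m)%type,
  measurable_fun [set: measurableTypeR R] g /\
  forall B, measurable B -> uniform_prob (@ltr01 R) (g @^-1` B) =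
    (uniform_prob (@ltr01 R) \x theta)%E B.
Proof.
have [j [k [mj mk jK]]] := @borel_embedding R m.
have [Q QE] := image_probability
  ((uniform_prob (@ltr01 R) \x theta)%E : probability _ R) mj.
have [g mg gQ] := quantile_transform Q.
exists (k \o g); split; first exact: measurableT_comp.
move=> B mB; rewrite comp_preimage gQ.
  by rewrite QE -comp_preimage (_ : k \o j = id)//; apply/funext.
by rewrite -[X in measurable X]setTI; exact: mk.
Qed.

(** * Wasserstein distance *)

Section eq_integral_measurable.
Import HBNNSimple.

(** The integral is built from simple functions, whose level sets are measurable. This moves
    integrals from a bare set function such as [Psi mu] to a probability that agrees with it on
    Borel sets. *)
Lemma eq_integral_measurable (d : measure_display) (T : measurableType d)
    (R : realType) (mu nu : set T -> \bar R) (D : set T) (f : T -> \bar R) :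
  (forall B, measurable B -> mu B = nu B) ->
  (\int[mu]_(x in D) f x = \int[nu]_(x in D) f x)%E.
Proof.
move=> mn; have H (h : {nnsfun T >-> R}) : sintegral mu h = sintegral nu h.
  by apply: eq_fsbigr => r _; rewrite mn.
rewrite /integral; congr (ereal_sup _ - ereal_sup _)%E;
  by apply/seteqP; split => _ [h hf <-]; exists h.
Qed.

End eq_integral_measurable.

(** * Euclidean neighbourhoods of closed sets *)

Section thickening.
Context {R : realType} {n : nat}.
Implicit Types C : set 'M[R]_(n, 1).

Definition thick C (e : R) : set 'M[R]_(n, 1) :=
  [set x | exists2 y, C y & edist x y < e].

Lemma open_thick C e : open (thick C e).
Proof.
rewrite openE => x [y Cy xy]; apply/nbhs_ballP.
(* Balls of the matrix topology are coordinatewise, so a Euclidean distance adds up n coordinate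
   errors; dividing by n + 1 keeps the total strictly below the slack, also for n = 0. *)
exists ((e - edist x y) / n.+1%:R) => /=.
  by rewrite divr_gt0// ?subr_gt0// ltr0n.
move=> z [_ xz]; exists y => //.
rewrite (le_lt_trans (ler_edistD x _ _))// -ltrBrDr.
apply: (@le_lt_trans _ _ (\sum_(i < n) (e - edist x y) / n.+1%:R)).
  apply: (le_trans (ler_enorm_sum _)); apply: ler_sum => i _.
  by rewrite !mxE distrC ltW//; exact: xz.
rewrite sumr_const card_ord -[ltLHS]mulr_natr -mulrA gtr_pMr ?subr_gt0//.
by rewrite mulrC ltr_pdivrMr// mul1r ltr_nat.
Qed.

Lemma subset_thick C e : 0 < e -> C `<=` thick C e.
Proof. by move=> e0 x Cx; exists x; rewrite ?edistxx. Qed.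

Lemma thick_thick C e1 e2 : thick (thick C e1) e2 `<=` thick C (e1 + e2).
Proof.
move=> x [y [z Cz yz] xy]; exists z => //.
by rewrite (le_lt_trans (ler_edistD y _ _))// addrC ltrD.
Qed.

Lemma le_thick C e1 e2 : e1 <= e2 -> thick C e1 `<=` thick C e2.
Proof. by move=> e12 x [y Cy xy]; exists y => //; exact: lt_le_trans e12. Qed.

Lemma bigcap_thick C : closed C -> \bigcap_k thick C k.+1%:R^-1 = C.
Proof.
move=> cC; apply/seteqP; split => [x xC|x Cx k _]; last first.
  by apply: subset_thick Cx; rewrite invr_gt0 ltr0n.
apply: cC => U /nbhs_ballP[e /= e0 eU].
have [k ke] : exists k : nat, k.+1%:R^-1 < e.
  exists (Num.truncn e^-1); rewrite -[ltRHS]invrK ltf_pV2 ?posrE ?invr_gt0//.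
  by rewrite truncnS_gt.
have [y Cy xy] := xC k I; exists y; split => //; apply: eU; split => // i j.
rewrite ord1 /ball/= (lt_trans _ ke)// (le_lt_trans _ xy)//.
by have := ler_coord_enorm (x - y) i; rewrite !mxE.
Qed.

Lemma borel_open C : open C -> measurable (C : set (Borel R n)).
Proof. exact: sub_sigma_algebra. Qed.

Lemma borel_closed C : closed C -> measurable (C : set (Borel R n)).
Proof.
by move=> cC; rewrite -(setCK C); apply: measurableC; apply: borel_open; exact: closed_openC.
Qed.

Lemma measure_thick_cvg (P : probability (Borel R n) R) C : closed C ->
  P (thick C k.+1%:R^-1 : set (Borel R n)) @[k --> \oo] --> P (C : set (Borel R n)).
Proof.
move=> cC; rewrite -{2}(bigcap_thick cC).
have mt k : measurable (thick C k.+1%:R^-1 : set (Borel R n)).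
  by apply: borel_open; exact: open_thick.
apply: nonincreasing_cvg_mu => //.
- by rewrite (le_lt_trans (probability_le1 _ _))// ltry.
- by apply: bigcap_measurable => //; exists 0%N.
- move=> k l kl; apply/subsetPset; apply: le_thick.
  by rewrite lef_pV2 ?posrE// ler_nat ltnS.
Qed.

(* Applied to the complement of a thickening, the one-sided bound also yields
   the reverse inequality on closed sets. *)
Lemma probability_eq_thick (P Q : probability (Borel R n) R) :
  (forall C e, closed C -> 0 < e ->
    (P (C : set (Borel R n)) <= Q (thick C e : set (Borel R n)))%E) ->
  forall B, measurable B -> P B = Q B.
Proof.
move=> PQ; have le1 C : closed C ->
    (P (C : set (Borel R n)) <= Q (C : set (Borel R n)))%E.
  move=> cC; apply: (cvge_to_ge (@measure_thick_cvg Q C cC)); apply: nearW => k.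
  by apply: PQ => //; rewrite invr_gt0 ltr0n.
have le2 C : closed C -> (Q (C : set (Borel R n)) <= P (C : set (Borel R n)))%E.
  move=> cC; apply: (cvge_to_ge (@measure_thick_cvg P C cC)); apply: nearW => k.
  set U := thick C _; have oU : open U by exact: open_thick.
  have mU : measurable (U : set (Borel R n)) by exact: borel_open.
  have mC : measurable (C : set (Borel R n)) by exact: borel_closed.
  apply: (@le_trans _ _ (Q (U : set (Borel R n)))).
    apply: le_measure; rewrite ?inE//; apply: subset_thick.
    by rewrite invr_gt0 ltr0n.
  have := le1 (~` U) (open_closedC oU).
  have SC (S : probability (Borel R n) R) : S (~` U) = (1 - S (U : set (Borel R n)))%E.
    exact: probability_setC.
  rewrite !SC => PQU.
  have pf : P (U : set (Borel R n)) \is a fin_num by exact: fin_num_measure.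
  have qf : Q (U : set (Borel R n)) \is a fin_num by exact: fin_num_measure.
  by move: PQU; rewrite -(fineK pf) -(fineK qf) -!EFinB !lee_fin; lra.
move=> B mB.
apply: (@measure_unique _ R (Borel R n) (open : set (set 'M[R]_(n, 1))) (fun=> setT)) => //.
- exact: openI.
- by move=> _; exact: openT.
- by rewrite bigcup_const.
- move=> U oU.
  have cU : closed (~` U) by exact: open_closedC.
  have mU : measurable (U : set (Borel R n)) by exact: borel_open.
  have H : P (~` U) = Q (~` U).
    by apply/eqP; rewrite eq_le; apply/andP; split; [exact: le1|exact: le2].
  have SC (S : probability (Borel R n) R) : S U = (1 - S (~` U))%E.
    by rewrite -[in LHS](setCK U); apply: probability_setC; exact: measurableC.
  by transitivity (1 - P (~` U))%E; [exact: SC|rewrite H; exact/esym/SC].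
- by move=> k; rewrite (le_lt_trans (probability_le1 _ _))// ltry.
Qed.

End thickening.

Section wasserstein.
Context {R : realType} {n : nat}.
Implicit Types mu nu : set (Borel R n) -> \bar R.

Lemma W1_meq mu mu' nu nu' : meq mu mu' -> meq nu nu' -> W1 mu nu = W1 mu' nu'.
Proof.
move=> mm nn; rewrite /W1; congr ereal_inf.
by apply/seteqP; split => _ [pi /= cpi <-]; exists pi => // B mB;
  have [-> ->] := cpi B mB; rewrite ?mm ?nn.
Qed.

Lemma meq_sym mu nu : meq mu nu -> meq nu mu.
Proof. by move=> mn B mB; rewrite mn. Qed.

Lemma P1_meq mu nu : meq mu nu -> P1 mu -> P1 nu.
Proof.
move=> mn [[P Pmu] foo]; split; first by exists P => B mB; rewrite Pmu// mn.
by rewrite -(eq_integral_measurable _ _ mn).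
Qed.

Lemma W1_ge0 mu nu : (0 <= W1 mu nu)%E.
Proof.
apply: le_ereal_inf_tmp => _ [pi _ <-].
by apply: integral_ge0 => p _; rewrite lee_fin edist_ge0.
Qed.

(** The joint law of [X] and [Y] is a coupling. Couplings are produced in this way throughout, from
    variables on a common space. *)
Lemma W1_le_image (d : measure_display) (T : measurableType d) (P : probability T R)
    (X Y : T -> Borel R n) mu nu :
  measurable_fun [set: T] X -> measurable_fun [set: T] Y ->
  (forall B, measurable B -> mu B = P (X @^-1` B)) ->
  (forall B, measurable B -> nu B = P (Y @^-1` B)) ->
  (W1 mu nu <= \int[P]_t (edist (X t) (Y t))%:E)%E.
Proof.
move=> mX mY muX nuY.
have mXY : measurable_fun [set: T] (fun t => (X t, Y t)) by exact: measurable_fun_pair.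
have [Q QE] := image_probability P mXY.
apply: ereal_inf_lbound; exists Q.
  by move=> B mB; rewrite !QE /= muX// nuY.
rewrite (ge0_integral_image mXY (fun B _ => QE B)
  (g := fun p : Borel R n * Borel R n => (edist p.1 p.2)%:E))//.
- exact: (measurable_edistE measurable_fst measurable_snd).
- by move=> p; rewrite lee_fin edist_ge0.
Qed.

(** The independent coupling costs at most the sum of the two first moments. *)
Lemma W1_lty (P Q : probability (Borel R n) R) :
  P1 P -> P1 Q -> (W1 P Q < +oo)%E.
Proof.
move=> [_ Poo] [_ Qoo].
have menorm (i : Borel R n * Borel R n -> Borel R n) : measurable_fun setT i ->
  measurable_fun [set: Borel R n * Borel R n] (fun p => (enorm (i p : 'M[R]_(n, 1)))%:E).
  exact: measurable_enormE.
have fstE B : measurable B -> P B = (P \x Q)%E (fst @^-1` B).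
  move=> mB; rewrite -setXT.
  have -> : (P \x Q)%E (B `*` setT) = (P B * Q setT)%E by exact: product_measure1E.
  by rewrite [Q setT]probability_setT mule1.
have sndE B : measurable B -> Q B = (P \x Q)%E (snd @^-1` B).
  move=> mB; rewrite -setTX.
  have -> : (P \x Q)%E (setT `*` B) = (P setT * Q B)%E by exact: product_measure1E.
  by rewrite [P setT]probability_setT mul1e.
apply: (le_lt_trans (W1_le_image measurable_fst measurable_snd fstE sndE)).
apply: (@le_lt_trans _ _ (\int[(P \x Q)%E]_p
    ((enorm (p.1 : 'M[R]_(n, 1)))%:E + (enorm (p.2 : 'M[R]_(n, 1)))%:E))%E).
  apply: ge0_le_integral => //.
  - by move=> p _; rewrite lee_fin edist_ge0.
  - exact: (measurable_edistE measurable_fst measurable_snd).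
  - by apply: emeasurable_funD; exact: menorm.
  - by move=> p _; rewrite -EFinD lee_fin ler_edist_enormD.
have e0 (i : Borel R n * Borel R n -> Borel R n) p :
  (0 <= (enorm (i p : 'M[R]_(n, 1)))%:E)%E by rewrite lee_fin enorm_ge0.
rewrite (ge0_integralD _ measurableT (fun p _ => e0 fst p) (menorm _ measurable_fst)
  (fun p _ => e0 snd p) (menorm _ measurable_snd)).
rewrite lte_add_pinfty//.
- rewrite -(ge0_integral_image measurable_fst fstE
    (g := fun x : Borel R n => (enorm (x : 'M[R]_(n, 1)))%:E))//.
  + exact: measurable_enormE.
  + by move=> x; rewrite lee_fin enorm_ge0.
- rewrite -(ge0_integral_image measurable_snd sndE
    (g := fun x : Borel R n => (enorm (x : 'M[R]_(n, 1)))%:E))//.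
  + exact: measurable_enormE.
  + by move=> x; rewrite lee_fin enorm_ge0.
Qed.

Lemma W1_fin mu nu : P1 mu -> P1 nu -> W1 mu nu \is a fin_num.
Proof.
move=> pmu pnu; have [[P Pmu] _] := pmu; have [[Q Qnu] _] := pnu.
rewrite ge0_fin_numE ?W1_ge0// -(W1_meq Pmu Qnu).
by apply: W1_lty; [apply: P1_meq pmu|apply: P1_meq pnu]; exact: meq_sym.
Qed.

(** When [X] is in [C], either [Y] is within [e] of it, hence in the thickening, or the distance is
    at least [e], an event controlled by Markov's inequality. *)
Lemma edist_tail (d : measure_display) (T : measurableType d) (P : probability T R)
    (X Y : T -> Borel R n) (C : set 'M[R]_(n, 1)) (e : R) :
  measurable_fun [set: T] X -> measurable_fun [set: T] Y ->
  measurable (C : set (Borel R n)) -> 0 < e ->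
  (P (X @^-1` C) <= P (Y @^-1` (thick C e)) +
     (e^-1)%:E * \int[P]_t (edist (X t) (Y t))%:E)%E.
Proof.
move=> mX mY mC' e0.
have mC : measurable (X @^-1` C).
  by rewrite -[X in measurable X]setTI; exact: mX.
have mt : measurable (Y @^-1` (thick C e)).
  by rewrite -[X in measurable X]setTI; apply: mY => //; apply: borel_open; exact: open_thick.
have md : measurable_fun [set: T] (fun t => (edist (X t) (Y t))%:E).
  exact: measurable_edistE.
pose E := [set t | (e%:E <= `|(edist (X t) (Y t))%:E|)%E].
have mE : measurable E.
  rewrite -[E]setTI; apply: emeasurable_fun_c_infty => //.
  exact: measurableT_comp.
have h := @le_integral_abse _ T R P setT measurableT _ e md e0.
rewrite setTI -/E in h.
have -> : (\int[P]_t (edist (X t) (Y t))%:E = \int[P]_t `|(edist (X t) (Y t))%:E|)%E.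
  by apply: eq_integral => t _; rewrite gee0_abs// lee_fin edist_ge0.
have PE : (P E <= (e^-1)%:E * \int[P]_t `|(edist (X t) (Y t))%:E|)%E.
  by rewrite lee_pdivlMl.
apply: (le_trans _ (leeD2l _ PE)).
apply: (le_trans _ (measureU2 _ mt mE)).
apply: le_measure; rewrite ?inE//; first exact: measurableU.
move=> t Xt; have [te|te] := ltP (edist (X t) (Y t)) e.
  by left; exists (X t) => //; rewrite edistC.
by right; rewrite /E /= lee_fin ger0_norm// edist_ge0.
Qed.

(** This Prokhorov-type estimate comes from a coupling of cost below [w]. Such estimates compose by
    enlarging the thickening, which stands in for a triangle inequality. *)
Lemma W1_thick mu nu (w e : R) (C : set 'M[R]_(n, 1)) :
  (W1 mu nu < w%:E)%E -> measurable (C : set (Borel R n)) -> 0 < e ->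
  (mu C <= nu (thick C e) + (w / e)%:E)%E /\ (nu C <= mu (thick C e) + (w / e)%:E)%E.
Proof.
move=> /ereal_inf_lt[_ [pi cpi <-]] piw mC e0.
have mt : measurable (thick C e : set (Borel R n)) by apply: borel_open; exact: open_thick.
have [C1 C2] := cpi _ mC; have [t1 t2] := cpi _ mt.
have piE : ((e^-1)%:E * \int[pi]_p (edist p.1 p.2)%:E <= (w / e)%:E)%E.
  by rewrite mulrC EFinM lee_pmul2l ?lte_fin ?invr_gt0// ltW.
split.
  have := edist_tail pi measurable_fst measurable_snd mC e0.
  by rewrite C1 t2 => /le_trans; apply; rewrite leeD2l.
have := edist_tail pi measurable_snd measurable_fst mC e0.
rewrite C2 t1 => /le_trans; apply; rewrite leeD2l//.
by under eq_integral do rewrite edistC.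
Qed.

Lemma W1_eq0 mu nu : P1 mu -> P1 nu -> W1 mu nu = 0%E -> meq mu nu.
Proof.
move=> [[P Pmu] _] [[Q Qnu] _] W0 B mB; rewrite -Pmu// -Qnu//.
apply: (@probability_eq_thick R n P Q _ B mB) => C e cC e0; apply/lee_addgt0Pr => w w0.
have mC : measurable (C : set (Borel R n)) by exact: borel_closed.
have mt : measurable (thick C e : set (Borel R n)) by apply: borel_open; exact: open_thick.
(* The bound [w * e] is chosen so that division by [e] in Markov's inequality leaves the arbitrary
   error [w]. *)
have W0w : (W1 mu nu < (w * e)%:E)%E by rewrite W0 lte_fin mulr_gt0.
have [+ _] := W1_thick W0w mC e0.
by rewrite mulfK ?gt_eqF// -(Pmu _ mC) -(Qnu _ mt).
Qed.

End wasserstein.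

Lemma P1_dirac0 (R : realType) (n : nat) :
  P1 (@dirac _ (Borel R n) (0 : 'M[R]_(n, 1)) R).
Proof.
split; first by exists (@dirac _ (Borel R n) (0 : 'M[R]_(n, 1)) R).
rewrite integral_dirac//; last by apply: measurable_enormE; exact: measurable_id.
by rewrite enorm0 mule0 ltry.
Qed.

(** * Limits *)

Lemma cvg_of_summable_increments (R : realType) (u : nat -> R) :
  (\sum_(0 <= j <oo) (`|u j.+1 - u j|)%:E < +oo)%E -> cvgn u.
Proof.
move=> uoo; pose v j := u j.+1 - u j.
have S0 : (0 <= \sum_(0 <= j <oo) (`|u j.+1 - u j|)%:E)%E.
  by apply: nneseries_ge0 => j _ _; rewrite lee_fin.
have : cvgn (series v).
  apply: normed_cvg; apply: nondecreasing_is_cvgn.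
    by apply: nondecreasing_series => j _ _; exact: normr_ge0.
  exists (fine (\sum_(0 <= j <oo) (`|u j.+1 - u j|)%:E)%E) => _ [k _ <-].
  rewrite -lee_fin fineK ?ge0_fin_numE// /series/= -sumEFin.
  by apply: nneseries_lim_ge => j _ _; rewrite lee_fin.
rewrite (_ : series v = (fun n => u n - u 0%N)); last first.
  by apply/funext => k; rewrite /series/= telescope_sumr.
move=> cv; have -> : u = (fun k => u k - u 0%N) \+ cst (u 0%N).
  by apply/funext => k /=; rewrite subrK.
exact: (is_cvgD cv (is_cvg_cst (u 0%N))).
Qed.

(** Finite total expected variation makes almost every path of finite length, so completeness is
    only used in R, coordinate by coordinate. Here [n] is the dimension. *)
Lemma L1_limit (d : measure_display) (T : measurableType d) (R : realType) (n : nat)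
    (P : probability T R) (Y : nat -> T -> Borel R n) :
  (forall k, measurable_fun [set: T] (Y k)) ->
  (\sum_(0 <= j <oo) \int[P]_t (edist (Y j.+1 t) (Y j t))%:E < +oo)%E ->
  exists2 Z : T -> Borel R n, measurable_fun [set: T] Z & forall k,
    (\int[P]_t (edist (Y k t) (Z t))%:E <= n%:R%:E *
      \sum_(0 <= j <oo) \int[P]_t (edist (Y (j + k).+1 t) (Y (j + k) t))%:E)%E.
Proof.
move=> mY Yoo.
pose S k t : \bar R := (\sum_(0 <= j <oo) (edist (Y (j + k)%N.+1 t) (Y (j + k)%N t))%:E)%E.
have d0 j t : (0 <= (edist (Y j.+1 t) (Y j t))%:E)%E by rewrite lee_fin edist_ge0.
have md j : measurable_fun [set: T] (fun t => (edist (Y j.+1 t) (Y j t))%:E).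
  exact: measurable_edistE.
have S0 k t : (0 <= S k t)%E by apply: nneseries_ge0 => j _ _; exact: d0.
have mS k : measurable_fun [set: T] (S k).
  by apply: ge0_emeasurable_sum => [j t _ _|j _]; [exact: d0|exact: md].
have iS k : (\int[P]_t S k t =
    \sum_(0 <= j <oo) \int[P]_t (edist (Y (j + k)%N.+1 t) (Y (j + k)%N t))%:E)%E.
  by rewrite integral_nneseries// => j t _; exact: d0.
have Soo : {ae P, forall t, (S 0%N t < +oo)%E}.
  have : P.-integrable setT (S 0%N).
    apply/integrableP; split => //.
    under eq_integral do rewrite gee0_abs//.
    by rewrite iS; under eq_eseriesr do rewrite addn0.
  move=> /(integrable_ae measurableT); apply: filterS => t St.
  by rewrite ltey_eq St.
(* The upper limit exists at every [t], so [Z] is measurable everywhere; it is the true limit on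
   paths of finite length. *)
pose Z t : Borel R n :=
  \matrix_(i, j) fine (limn_esup (fun k => ((Y k t : 'M[R]_(n, 1)) i ord0)%:E)).
have mZ : measurable_fun [set: T] Z.
  apply: measurable_fun_coordP => i; under eq_fun do rewrite mxE.
  have : measurable_fun [set: T]
      (fun t => limn_esup (fun k => ((Y k t : 'M[R]_(n, 1)) i ord0)%:E)).
    apply: measurable_fun_limn_esup => k; apply/measurable_EFinP.
    exact: measurable_fun_coord.
  by apply: measurableT_comp; exact: fine_measurable.
exists Z => // k; rewrite -iS -ge0_integralZl_EFin//.
apply: ae_ge0_le_integral => //.
- by move=> t _; rewrite lee_fin edist_ge0.
- exact: measurable_edistE.
- by move=> t _; rewrite mule_ge0.
- exact: measurable_funeM.
apply: filterS Soo => t St _.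
have coord_le j i : `|(Y j.+1 t : 'M[R]_(n, 1)) i ord0 - (Y j t : 'M[R]_(n, 1)) i ord0|
    <= edist (Y j.+1 t) (Y j t).
  by have := ler_coord_enorm ((Y j.+1 t : 'M[R]_(n, 1)) - Y j t) i; rewrite !mxE.
have Yle i : ((`|(Y k t : 'M[R]_(n, 1)) i ord0 - (Z t : 'M[R]_(n, 1)) i ord0|)%:E <= S k t)%E.
  pose u j := (Y j t : 'M[R]_(n, 1)) i ord0.
  have cu : cvgn u.
    apply: cvg_of_summable_increments; apply: le_lt_trans St.
    apply: lee_nneseries => [j _ _|j _]; first by rewrite lee_fin.
    by rewrite addn0 lee_fin; exact: coord_le.
  have eu : (EFin \o u) @ \oo --> (limn u)%:E by apply: cvg_EFin => //; exact: nearW.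
  have -> : (Z t : 'M[R]_(n, 1)) i ord0 = limn u.
    by rewrite mxE is_cvg_limn_esupE ?(cvg_lim _ eu)//; apply: cvgP eu.
  have : (EFin \o (fun j => `|u k - u (j + k)%N|)) @ \oo --> (`|u k - limn u|)%:E.
    apply: cvg_EFin; first exact: nearW.
    apply: cvg_norm; apply: cvgB; first exact: cvg_cst.
    by rewrite (cvg_shiftn k u).
  move/cvge_to_le; apply; apply: nearW => j /=.
  apply: (@le_trans _ _ (\sum_(0 <= l < j) (edist (Y (l + k)%N.+1 t) (Y (l + k)%N t))%:E)%E).
    rewrite sumEFin lee_fin distrC.
    rewrite (_ : _ - _ = \sum_(0 <= l < j) (u (l + k).+1 - u (l + k)%N)); last first.
      by rewrite (telescope_sumr (fun l => u (l + k)%N)).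
    rewrite (le_trans (ler_norm_sum _ _ _))// ler_sum// => l _.
    exact: coord_le.
  by apply: nneseries_lim_ge => l _ _; exact: d0.
(* The dimension factor arises here: the norm is at most the sum of n coordinate errors, each
   bounded by the remaining path length. *)
apply: (@le_trans _ _ (\sum_(i < n) S k t)%E).
  apply: (@le_trans _ _ (\sum_(i < n)
      (`|(Y k t : 'M[R]_(n, 1)) i ord0 - (Z t : 'M[R]_(n, 1)) i ord0|)%:E)%E).
    rewrite sumEFin lee_fin (le_trans (ler_enorm_sum _))// ler_sum// => i _.
    by rewrite !mxE.
  by apply: lee_sum => i _; exact: Yle.
by rewrite sumr_const card_ord mule_natl.
Qed.

Lemma geometric_lt (R : realType) (c k w : R) : 0 < k < 1 -> 0 < w ->
  exists n, c * k ^+ n < w.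
Proof.
move=> /andP[k0 k1] w0.
have k1' : `|k| < 1 by rewrite gtr0_norm.
have /cvgr_lt/(_ _ w0)[N _ /(_ N (leqnn N)) h] := cvg_geometric c k1'.
by exists N.
Qed.

Lemma limn_esup_lne_lt0 (R : realType) (u : nat -> \bar R) (c k : R) :
  0 < k < 1 -> (forall n, 0%R <= u n <= (c * k ^+ n)%:E)%E ->
  (limn_esup (fun n => (n%:R^-1)%:E * lne (u n)) < 0)%E.
Proof.
move=> /andP[k0 k1] ub.
have lk0 : ln k < 0 by rewrite ln_lt0// k0.
apply: (@le_lt_trans _ _ (ln k / 2)%:E); last by rewrite lte_fin; lra.
(* From this rank on, [c] costs at most half of the rate, leaving [ln k / 2]; the successor also
   excludes n = 0. *)
pose N := (Num.truncn (2 * ln c / - ln k)).+1.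
apply: (@le_trans _ _ (ereal_sup [set (n%:R^-1)%:E * lne (u n) | n in [set n | (N <= n)%N]])%E).
  by apply: ereal_inf_lbound; exists [set n | (N <= n)%N] => //; exists N.
apply: ge_ereal_sup => _ [n /= Nn <-].
have n0 : (0 : R) < n%:R by rewrite ltr0n (leq_trans _ Nn).
have /andP[u0 uc] := ub n.
(* If [u n] vanishes, its logarithm is [-oo], and so is the product since 1/n is positive. *)
have [ul|ul] := leP (u n) 0%E.
  by rewrite le0_lneNy// gt0_muleNy ?leNye// lte_fin invr_gt0.
have ufin : u n \is a fin_num by rewrite ge0_fin_numE// (le_lt_trans uc)// ltry.
move: ul uc; rewrite -(fineK ufin) lte_fin lee_fin; set r := fine _ => r0 rc.
rewrite lne_EFin// -EFinM lee_fin ler_pdivrMl//.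
have kn0 : 0 < k ^+ n by rewrite exprn_gt0.
have c0 : 0 < c by rewrite -(pmulr_lgt0 _ kn0) (lt_le_trans r0).
apply: (@le_trans _ _ (ln (c * k ^+ n))); first by rewrite ler_ln ?posrE ?mulr_gt0.
rewrite lnM ?posrE// lnXn// -mulr_natl.
have : 2 * ln c / - ln k < n%:R.
  by rewrite (lt_le_trans (truncnS_gt _))// ler_nat.
rewrite ltr_pdivrMr ?oppr_gt0//; lra.
Qed.

(** * The map Psi *)

Section lipschitz_constant.
Context {R : realType} {d m : nat}.
Variable f : 'M[R]_(d,1) -> (set (Borel R d) -> \bar R) -> 'M[R]_(m,1) -> 'M[R]_(d,1).

Lemma Dlip_ge0 z : (0 <= Dlip f z)%E.
Proof.
apply: ereal_sup_ubound; exists 0, (@dirac _ (Borel R d) (0 : 'M[R]_(d,1)) R).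
exists 0, (@dirac _ (Borel R d) (0 : 'M[R]_(d,1)) R); do 2 (split; first exact: P1_dirac0).
(* A zero numerator gives 0 in every branch of [eratio], so [W1] of the Dirac mass to itself need
   not be computed. *)
by rewrite /eratio !edistxx eqxx mul0r; case: ifP => //; case: ifP.
Qed.

Lemma Dlip_lipschitz z x1 mu1 x2 mu2 : (Dlip f z < +oo)%E -> P1 mu1 -> P1 mu2 ->
  edist (f x1 mu1 z) (f x2 mu2 z) <=
    fine (Dlip f z) * (edist x1 x2 + fine (W1 mu1 mu2)).
Proof.
move=> Doo p1 p2; set r := edist x1 x2 + _.
have D0 := Dlip_ge0 z.
have Dfin : Dlip f z \is a fin_num by rewrite ge0_fin_numE.
have w0 : 0 <= fine (W1 mu1 mu2) by rewrite fine_ge0// W1_ge0.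
have : (eratio (edist (f x1 mu1 z) (f x2 mu2 z)) r%:E <= Dlip f z)%E.
  apply: ereal_sup_ubound; exists x1, mu1, x2, mu2; split => //; split => //.
  by rewrite /r EFinD fineK// W1_fin.
have r0 : 0 <= r by rewrite addr_ge0// edist_ge0.
(* At [r = 0] the ratio is [+oo] unless the numerator vanishes, and finiteness of [Dlip f z]
   excludes that value. *)
rewrite /eratio eqe; case: ifPn => [/eqP ->|r0'].
  case: ifPn => [/eqP -> _|_]; first by rewrite mulr0.
  by rewrite leye_eq => /eqP D; rewrite D ltxx in Doo.
rewrite /= -{1}(fineK Dfin) lee_fin ler_pdivrMr//.
by rewrite lt_def r0' r0.
Qed.

End lipschitz_constant.

(** * Contraction estimates for [Psi] and its fixed point *)

Section transition.
Context {R : realType} {d m : nat}.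
Variables (A : 'M[R]_d) (delta : R) (theta : probability (Borel R m) R).
Variable f : 'M[R]_(d,1) -> (set (Borel R d) -> \bar R) -> 'M[R]_(m,1) -> 'M[R]_(d,1).
Hypothesis hf : forall mu : set (Borel R d) -> \bar R, P1 mu ->
  measurable_fun [set: (Borel R d * Borel R m)%type]
    (fun p : (Borel R d * Borel R m)%type => (f p.1 mu p.2 : Borel R d)).
Hypothesis hD : measurable_fun [set: Borel R m] (Dlip f : Borel R m -> \bar R).
Hypothesis hA1 : (\int[theta]_z Dlip f z < +oo)%E.
Hypothesis hA2 : (\int[theta]_z
  (enorm (f 0 (@dirac _ (Borel R d) (0 : 'M[R]_(d,1)) R) z))%:E < +oo)%E.
Hypothesis hdelta0 : 0 < delta.

Implicit Types mu nu : set (Borel R d) -> \bar R.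

Let sigma : R := fine (\int[theta]_z Dlip f z)%E.

Let PsiA := Psi A delta f theta.

Definition step mu (x : 'M[R]_(d,1)) (z : 'M[R]_(m,1)) : 'M[R]_(d,1) :=
  A *m x + delta *: f x mu z.

Lemma measurable_step (d' : measure_display) (T : measurableType d') mu
    (X : T -> Borel R d) (Z : T -> Borel R m) : P1 mu ->
  measurable_fun [set: T] X -> measurable_fun [set: T] Z ->
  measurable_fun [set: T] (fun t => step mu (X t) (Z t) : Borel R d).
Proof.
move=> pmu mX mZ; apply: measurable_add_mx; first exact: measurable_mulmx.
apply: measurable_scale_mx.
exact: (measurableT_comp (hf pmu) (measurable_fun_pair mX mZ)).
Qed.

Lemma sigma_ge0 : 0 <= sigma.
Proof. by rewrite fine_ge0// integral_ge0// => z _; exact: Dlip_ge0. Qed.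

(** [fine] changes [Dlip f] only where it is infinite, a null set by (A1). *)
Lemma integral_DlipE : (\int[theta]_z (fine (Dlip f z))%:E = sigma%:E)%E.
Proof.
rewrite /sigma fineK; last first.
  by rewrite ge0_fin_numE// integral_ge0// => z _; exact: Dlip_ge0.
apply: ge0_ae_eq_integral => //.
- by apply/measurable_EFinP; apply: measurableT_comp => //; exact: fine_measurable.
- by move=> z _; rewrite lee_fin fine_ge0// Dlip_ge0.
- by move=> z _; exact: Dlip_ge0.
- have : theta.-integrable setT (Dlip f : Borel R m -> \bar R).
    apply/integrableP; split => //.
    by under eq_integral do rewrite gee0_abs ?Dlip_ge0//.
  move=> /(integrable_ae measurableT); apply: filterS => z Dz _.
  by rewrite fineK//; exact: Dz.
Qed.

Lemma ae_Dlip_lty : {ae theta, forall z : Borel R m, (Dlip f z < +oo)%E}.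
Proof.
have : theta.-integrable setT (Dlip f : Borel R m -> \bar R).
  apply/integrableP; split => //.
  by under eq_integral do rewrite gee0_abs ?Dlip_ge0//.
move=> /(integrable_ae measurableT); apply: filterS => z Dz.
by rewrite ltey_eq Dz.
Qed.

(** The integral of sections defining [Psi] is a product measure, and its outer integral can be
    transported to any space carrying a variable of law [mu]. Hence couplings on that space act on
    images under [Psi]. *)
Lemma Psi_image (d' : measure_display) (T : measurableType d') (P : probability T R)
    mu (X : T -> Borel R d) B : P1 mu ->
  measurable_fun [set: T] X -> (forall B, measurable B -> mu B = P (X @^-1` B)) ->
  measurable B ->
  PsiA mu B = (P \x theta)%E ((fun p : T * Borel R m => step mu (X p.1) p.2) @^-1` B).
Proof.
move=> pmu mX muX mB.
have [[Q Qmu] _] := pmu.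
pose E := (fun p : Borel R d * Borel R m => step mu p.1 p.2) @^-1` B.
have mE : measurable E.
  rewrite -[E]setTI; apply: (measurable_step pmu measurable_fst measurable_snd) => //.
rewrite /PsiA /Psi -(eq_integral_measurable _ _ Qmu).
transitivity (\int[Q]_x (theta (xsection E x)))%E.
  apply: eq_integral => x _; congr (theta _); apply/seteqP; split => z /=.
    by move=> h; apply: mem_set.
  by rewrite /xsection/= inE.
rewrite (ge0_integral_image mX (m1 := P)).
- rewrite /product_measure1 /=; apply: eq_integral => t _; congr (theta _).
- by move=> C mC; transitivity (mu C); [exact: Qmu|exact: muX].
- exact: measurable_fun_xsection.
- by move=> y; exact: measure_ge0.
Qed.

Lemma edist_step z x mu y nu : (Dlip f z < +oo)%E -> P1 mu -> P1 nu ->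
  edist (step mu x z) (step nu y z) <=
    opnorm A * edist x y + delta * fine (Dlip f z) * (edist x y + fine (W1 mu nu)).
Proof.
move=> Doo pmu pnu.
have -> : edist (step mu x z) (step nu y z) =
    enorm (A *m (x - y) + delta *: (f x mu z - f y nu z)).
  by rewrite /edist /step mulmxBr scalerBr opprD addrACA.
apply: (le_trans (ler_enormD _ _)); apply: lerD; first exact: ler_enorm_mulmx.
rewrite enormZ gtr0_norm// -mulrA ler_pM2l//.
exact: Dlip_lipschitz.
Qed.

(** Both points receive the same noise, which is integrated first and enters only through the mean
    [sigma]. The law term stays separate so that each use can bound [W1 mu nu] by its own
    coupling. *)
Lemma integral_edist_step (d' : measure_display) (T : measurableType d')
    (P : probability T R) mu nu (X Y : T -> Borel R d) : P1 mu -> P1 nu ->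
  measurable_fun [set: T] X -> measurable_fun [set: T] Y ->
  (\int[(P \x theta)%E]_p (edist (step mu (X p.1) p.2) (step nu (Y p.1) p.2))%:E
   <= (opnorm A + delta * sigma)%:E * \int[P]_t (edist (X t) (Y t))%:E
      + (delta * sigma)%:E * W1 mu nu)%E.
Proof.
move=> pmu pnu mX mY; set w := fine (W1 mu nu).
have wE : (W1 mu nu = w%:E)%E by rewrite fineK// W1_fin.
have w0 : 0 <= w by rewrite fine_ge0// W1_ge0.
have a0 := opnorm_ge0 A.
have mXY : measurable_fun [set: T] (fun t => (edist (X t) (Y t))%:E) by exact: measurable_edistE.
have d0 t : 0 <= edist (X t) (Y t) by exact: edist_ge0.
have mF : measurable_fun [set: T * Borel R m] (fun p =>
    (edist (step mu (X p.1) p.2) (step nu (Y p.1) p.2))%:E).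
  apply: measurable_edistE; (apply: measurable_step; [by []| |exact: measurable_snd]).
    exact: (measurableT_comp mX measurable_fst).
  exact: (measurableT_comp mY measurable_fst).
rewrite fubini_tonelli1//=; last by move=> p; rewrite lee_fin edist_ge0.
have mfD : measurable_fun [set: Borel R m] (fun z => (fine (Dlip f z))%:E).
  by apply/measurable_EFinP; apply: measurableT_comp => //; exact: fine_measurable.
have fD0 z : 0 <= fine (Dlip f z) by rewrite fine_ge0// Dlip_ge0.
have inner t : (\int[theta]_z (edist (step mu (X t) z) (step nu (Y t) z))%:E <=
    (opnorm A + delta * sigma)%:E * (edist (X t) (Y t))%:E + (delta * sigma * w)%:E)%E.
  set r := edist (X t) (Y t).
  apply: (@le_trans _ _ (\int[theta]_z ((opnorm A * r)%:E +
      (delta * (r + w))%:E * (fine (Dlip f z))%:E))%E).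
    apply: ae_ge0_le_integral => //.
    - by move=> z _; rewrite lee_fin edist_ge0.
    - apply: measurable_edistE; (apply: measurable_step; [by []|exact: measurable_cst|exact: measurable_id]).
    - move=> z _; rewrite -EFinM -EFinD lee_fin addr_ge0 ?mulr_ge0 ?addr_ge0 ?d0 ?fD0//.
      exact: ltW.
    - by apply: emeasurable_funD => //; exact: measurable_funeM.
    - apply: filterS ae_Dlip_lty => z Dz _; rewrite -EFinM -EFinD lee_fin.
      by rewrite (le_trans (edist_step (X t) (Y t) Dz pmu pnu))// -/r -/w lerD2l; lra.
  have dr0 : 0 <= delta * (r + w) by rewrite mulr_ge0 ?addr_ge0 ?d0//; exact: ltW.
  rewrite ge0_integralD//; last 3 first.
  - by move=> z _; rewrite lee_fin mulr_ge0// d0.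
  - by move=> z _; rewrite mule_ge0// lee_fin.
  - exact: measurable_funeM.
  rewrite integral_cst_probability ge0_integralZl_EFin//; last first.
    by move=> z _; rewrite lee_fin.
  by rewrite integral_DlipE -!EFinM -EFinD lee_fin; lra.
apply: (@le_trans _ _ (\int[P]_t ((opnorm A + delta * sigma)%:E * (edist (X t) (Y t))%:E
    + (delta * sigma * w)%:E))%E).
  apply: ge0_le_integral => //.
  - by move=> t _; apply: integral_ge0 => z _; rewrite lee_fin edist_ge0.
  - have := @measurable_fun_fubini_tonelli_F _ _ _ _ _ theta _ mF; apply.
    by move=> p; rewrite lee_fin edist_ge0.
  - by apply: emeasurable_funD => //; exact: measurable_funeM.
  - by move=> t _; exact: inner.
have c0 : 0 <= opnorm A + delta * sigma.
  by rewrite addr_ge0// mulr_ge0 ?sigma_ge0//; exact: ltW.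
rewrite ge0_integralD//; last 3 first.
- by move=> t _; rewrite -EFinM lee_fin mulr_ge0.
- exact: measurable_funeM.
- by move=> t _; rewrite lee_fin !mulr_ge0 ?sigma_ge0//; exact: ltW.
rewrite integral_cst_probability ge0_integralZl_EFin//; last first.
  by move=> t _; rewrite lee_fin.
by rewrite wE -EFinM.
Qed.

Lemma P1_Psi mu : P1 mu -> P1 (PsiA mu).
Proof.
move=> pmu; have [[Q Qmu] Qoo] := pmu.
have pQ : P1 Q by apply: (P1_meq _ pmu) => B mB; rewrite Qmu.
have mS : measurable_fun [set: Borel R d * Borel R m]
    (fun p => step mu p.1 p.2 : Borel R d).
  exact: (measurable_step pmu measurable_fst measurable_snd).
have [S SE] := @image_probability _ _ _ (Borel R d) R (Q \x theta)%E _ mS.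
have SPsi : meq S (PsiA mu).
  by move=> B mB; rewrite SE (@Psi_image _ _ Q mu id) => // C mC; rewrite Qmu.
split; first by exists S.
rewrite -(eq_integral_measurable _ _ SPsi).
rewrite (ge0_integral_image mS (fun B _ => SE B)
  (g := fun x : Borel R d => (enorm (x : 'M[R]_(d, 1)))%:E)); last 2 first.
- exact: measurable_enormE.
- by move=> x; rewrite lee_fin enorm_ge0.
set d0 := @dirac _ (Borel R d) (0 : 'M[R]_(d,1)) R.
have p0 : P1 d0 by exact: P1_dirac0.
have m0 : measurable_fun [set: Borel R d * Borel R m]
    (fun p => step d0 0 p.2 : Borel R d).
  have mz : measurable_fun [set: Borel R d * Borel R m] (fun=> 0 : Borel R d).
    exact: measurable_cst.
  exact: (measurable_step p0 mz measurable_snd).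
(* The reference point is the update of 0 under the Dirac law: the distance to it is controlled by
   the Lipschitz estimate, and its own moment is [delta] times the integral in (A2). *)
apply: (@le_lt_trans _ _ (\int[(Q \x theta)%E]_p
   ((edist (step mu p.1 p.2) (step d0 0 p.2))%:E + (enorm (step d0 0 p.2))%:E))%E).
  apply: ge0_le_integral => //.
  - by move=> p _; rewrite lee_fin enorm_ge0.
  - exact: measurable_enormE.
  - by apply: emeasurable_funD; [exact: measurable_edistE|exact: measurable_enormE].
  - by move=> p _; rewrite -EFinD lee_fin ler_enorm_edist.
rewrite ge0_integralD//; last 4 first.
- by move=> p _; rewrite lee_fin edist_ge0.
- exact: measurable_edistE.
- by move=> p _; rewrite lee_fin enorm_ge0.
- exact: measurable_enormE.
apply: lte_add_pinfty.
  apply: (le_lt_trans (@integral_edist_step _ _ Q mu d0 id (fun=> 0) pmu p0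
    (@measurable_id _ _ setT) _)); first exact: measurable_cst.
  rewrite -(fineK (W1_fin pmu p0)) -EFinM lte_add_pinfty ?ltry//.
  apply: lte_mul_pinfty => //.
    by rewrite lee_fin addr_ge0 ?opnorm_ge0// mulr_ge0 ?sigma_ge0// ltW.
  under eq_integral do rewrite edistx0.
  by rewrite (eq_integral_measurable _ _ Qmu).
rewrite (@fubini_tonelli1 _ _ _ _ _ Q theta
  (fun p : Borel R d * Borel R m => (enorm (step d0 0 p.2))%:E)).
- rewrite /fubini_F /= (_ : (fun=> _) = (fun=> (delta%:E * \int[theta]_z (enorm (f 0 d0 z))%:E)%E)).
    rewrite -[X in (_ * X)%E]fineK; last first.
      by rewrite ge0_fin_numE// integral_ge0// => z _; rewrite lee_fin enorm_ge0.
    by rewrite -EFinM integral_cst_probability ltry.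
  apply/funext => x; rewrite -ge0_integralZl_EFin//.
  + by apply: eq_integral => z _; rewrite /step mulmx0 add0r enormZ gtr0_norm.
  + by move=> z _; rewrite lee_fin enorm_ge0.
  + apply: measurable_enormE.
    have mz : measurable_fun [set: Borel R m] (fun=> 0 : Borel R d) by exact: measurable_cst.
    have mi : measurable_fun [set: Borel R m] (@id (Borel R m)) by exact: measurable_id.
    have := measurableT_comp (hf p0) (measurable_fun_pair mz mi); exact.
  + exact: ltW.
- exact: measurable_enormE.
- by move=> p; rewrite lee_fin enorm_ge0.
Qed.

Lemma P1_iter_Psi mu n : P1 mu -> P1 (iter n PsiA mu).
Proof. by move=> pmu; elim: n => //= n ih; exact: P1_Psi. Qed.

Lemma W1_Psi mu nu : P1 mu -> P1 nu ->
  (W1 (PsiA mu) (PsiA nu) <= (opnorm A + 2 * delta * sigma)%:E * W1 mu nu)%E.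
Proof.
move=> pmu pnu; rewrite -(fineK (W1_fin pmu pnu)) -EFinM.
set w := fine _; set c := opnorm A + delta * sigma.
have c0 : 0 <= c by rewrite addr_ge0 ?opnorm_ge0// mulr_ge0 ?sigma_ge0// ltW.
apply/lee_addgt0Pr => e e0.
have c1 : 0 < c + 1 by rewrite ltr_wpDl.
(* An optimal coupling is replaced by one with slack [e / (c + 1)]: multiplied by [c] the slack
   stays below [e], and the denominator is positive even if [c] is 0. *)
have : (W1 mu nu < (w + e / (c + 1))%:E)%E.
  by rewrite -(fineK (W1_fin pmu pnu)) lte_fin -/w ltrDl divr_gt0.
move=> /ereal_inf_lt[_ [pi cpi <-] piw].
apply: (@le_trans _ _ (c%:E * \int[pi]_p (edist p.1 p.2)%:E
    + (delta * sigma)%:E * W1 mu nu)%E).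
  apply: (le_trans _ (integral_edist_step pi pmu pnu measurable_fst measurable_snd)).
  apply: W1_le_image.
  - apply: (measurable_step pmu _ measurable_snd).
    exact: (measurableT_comp measurable_fst measurable_fst).
  - apply: (measurable_step pnu _ measurable_snd).
    exact: (measurableT_comp measurable_snd measurable_fst).
  - by move=> B; apply: (Psi_image pmu measurable_fst) => C /cpi[].
  - by move=> B; apply: (Psi_image pnu measurable_snd) => C /cpi[].
apply: (@le_trans _ _ (c%:E * (w + e / (c + 1))%:E + (delta * sigma)%:E * w%:E)%E).
  rewrite leeD//; last by rewrite fineK// W1_fin.
  by rewrite lee_wpmul2l ?lee_fin// ltW.
rewrite -!EFinM -!EFinD lee_fin mulrDr.
have : c * (e / (c + 1)) <= e.
  by rewrite mulrCA ler_piMr ?ltW// ltr_pdivrMr// mul1r ltrDl.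
by rewrite /c; lra.
Qed.


Lemma Psi_fixpoint (k : R) : 0 < k < 1 -> opnorm A + 2 * delta * sigma <= k ->
  exists2 mu, P1 mu & meq (PsiA mu) mu.
Proof.
move=> /andP[k0 k1] kappa_k.
have [g [mg gE]] := uniform_split theta.
pose U : probability (measurableTypeR R) R := uniform_prob (@ltr01 R).
pose mu_ j := iter j PsiA (@dirac _ (Borel R d) (0 : 'M[R]_(d,1)) R).
have pmu j : P1 (mu_ j) by apply: P1_iter_Psi; exact: P1_dirac0.
pose Y := fix Y j (w : measurableTypeR R) : Borel R d :=
  if j is j'.+1 then step (mu_ j') (Y j' (g w).1) (g w).2 else 0.
have mg1 := measurableT_comp measurable_fst mg.
have mg2 := measurableT_comp measurable_snd mg.
have mY j : measurable_fun [set: measurableTypeR R] (Y j).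
  elim: j => [|j ih]; first exact: measurable_cst.
  exact: (measurable_step (pmu j) (measurableT_comp ih mg1) mg2).
have mS i j : measurable_fun [set: measurableTypeR R * Borel R m]
    (fun p => step (mu_ i) (Y j p.1) p.2 : Borel R d).
  exact: (measurable_step (pmu i) (measurableT_comp (mY j) measurable_fst) measurable_snd).
have lawY j B : measurable B -> mu_ j B = U (Y j @^-1` B).
  elim: j B => [|j ih] B mB.
    rewrite /mu_ /= diracE; have [B0|B0] := boolP (0 \in B).
      rewrite (_ : Y 0%N @^-1` B = setT) ?[RHS]probability_setT//.
      by apply/seteqP; split => // w _; rewrite /= inE in B0 *.
    rewrite (_ : Y 0%N @^-1` B = set0) ?measure0//.
    by apply/seteqP; split => // w /= Bw; move: B0; rewrite notin_setE.
  rewrite /mu_ iterS -/(mu_ j) (Psi_image (P := U) (pmu j) (mY j) ih mB) -gE//.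
  by rewrite -[X in measurable X]setTI; exact: mS.
pose e j : \bar R := (\int[U]_w (edist (Y j.+1 w) (Y j w))%:E)%E.
have e_ge0 j : (0 <= e j)%E.
  by apply: integral_ge0 => w _; rewrite lee_fin edist_ge0.
have W1e j : (W1 (mu_ j.+1) (mu_ j) <= e j)%E.
  by apply: W1_le_image => //; exact: lawY.
have ds0 : 0 <= delta * sigma by rewrite mulr_ge0 ?sigma_ge0// ltW.
(* Pushing [U] through [g] exposes the common outermost noise. The law term is then bounded by [e j]
   as well, since the pair [Y j.+1], [Y j] is itself a coupling of [mu_ j.+1] and [mu_ j]. *)
have eS j : (e j.+1 <= k%:E * e j)%E.
  rewrite [leLHS](_ : _ = \int[(U \x theta)%E]_p
      (edist (step (mu_ j.+1) (Y j.+1 p.1) p.2) (step (mu_ j) (Y j p.1) p.2))%:E)%E; last first.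
    apply/esym; apply: (ge0_integral_image mg) => [B mB||p].
    - exact/esym/gE.
    - exact: (measurable_edistE (mS j.+1 j.+1) (mS j j)).
    - by rewrite lee_fin edist_ge0.
  apply: (le_trans (integral_edist_step U (pmu _) (pmu _) (mY _) (mY _))).
  apply: (@le_trans _ _ ((opnorm A + delta * sigma)%:E * e j + (delta * sigma)%:E * e j)%E).
    by rewrite leeD2l// lee_wpmul2l ?lee_fin.
  rewrite -ge0_muleDl ?lee_fin ?addr_ge0 ?opnorm_ge0//.
  by rewrite -EFinD lee_wpmul2r// lee_fin; lra.
(* As [Y 0] is constantly 0, this is the first moment of [mu_ 1]. *)
have e0oo : (e 0%N < +oo)%E.
  rewrite /e; under eq_integral do rewrite edistx0.
  have [[Q QE] Qoo] := pmu 1%N.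
  have QY B : measurable B -> Q B = U (Y 1%N @^-1` B) by move=> mB; rewrite QE// lawY.
  rewrite -(ge0_integral_image (mY 1%N) QY
    (g := fun x : Borel R d => (enorm (x : 'M[R]_(d, 1)))%:E)).
  - by rewrite (eq_integral_measurable _ _ QE).
  - exact: measurable_enormE.
  - by move=> x; rewrite lee_fin enorm_ge0.
pose c := fine (e 0%N).
have c0 : 0 <= c by rewrite fine_ge0.
have e_le j : (e j <= (c * k ^+ j)%:E)%E.
  elim: j => [|j ih]; first by rewrite expr0 mulr1 fineK// ge0_fin_numE.
  apply: (le_trans (eS j)); apply: (@le_trans _ _ (k%:E * (c * k ^+ j)%:E)%E).
    by rewrite lee_wpmul2l// lee_fin ltW.
  by rewrite -EFinM lee_fin exprS mulrCA.
have k1' : 0 < 1 - k by lra.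
pose C := c / (1 - k).
have tail_le l : (\sum_(0 <= j <oo) e (j + l)%N <= (C * k ^+ l)%:E)%E.
  apply: lime_le; first by apply: is_cvg_nneseries => j _ _; exact: e_ge0.
  apply: nearW => N.
  apply: (@le_trans _ _ (\sum_(0 <= j < N) (c * k ^+ (j + l))%:E)%E).
    by apply: lee_sum => j _; exact: e_le.
  rewrite sumEFin lee_fin.
  have -> : \sum_(0 <= j < N) c * k ^+ (j + l) = C * k ^+ l * (1 - k ^+ N).
    elim: N => [|N ih]; first by rewrite big_geq// expr0 subrr mulr0.
    by rewrite big_nat_recr//= ih exprS exprD /C; field; rewrite gt_eqF.
  rewrite ler_piMr ?mulr_ge0 ?invr_ge0 ?exprn_ge0 ?(ltW k0) ?(ltW k1')//.
  by rewrite gerBl exprn_ge0// ltW.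
have [|Z mZ YZ] := L1_limit (P := U) mY.
  apply: le_lt_trans (ltry (C * k ^+ 0)); apply: le_trans (tail_le 0%N).
  by under [leRHS]eq_eseriesr do rewrite addn0.
have {}YZ l : (\int[U]_w (edist (Y l w) (Z w))%:E <= (d%:R * C * k ^+ l)%:E)%E.
  apply: (le_trans (YZ l)); rewrite -mulrA EFinM lee_wpmul2l ?lee_fin//.
  exact: tail_le.
have [M ME] := @image_probability _ _ _ (Borel R d) R U Z mZ.
have pM : P1 M.
  split; first by exists M.
  rewrite (ge0_integral_image mZ (fun B _ => ME B)
    (g := fun x : Borel R d => (enorm (x : 'M[R]_(d, 1)))%:E)).
  - apply: le_lt_trans (ltry (d%:R * C * k ^+ 0)); apply: le_trans (YZ 0%N).
    by under [leRHS]eq_integral do rewrite edistC edistx0.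
  - exact: measurable_enormE.
  - by move=> x; rewrite lee_fin enorm_ge0.
have W1M l : (W1 (mu_ l) M <= (d%:R * C * k ^+ l)%:E)%E.
  by apply: (le_trans _ (YZ l)); apply: W1_le_image => //; exact: lawY.
exists M => //.
have [[N NE] _] := P1_Psi pM.
move=> B mB; rewrite -(NE _ mB).
(* [mu_ l.+1] serves as intermediary between [PsiA M] and [M]: passing through it thickens twice by
   [r / 2] and costs [w / 2] each time, whence the choice of [v] below. *)
apply: (@probability_eq_thick R d N M _ B mB) => K r cK r0; apply/lee_addgt0Pr => w w0.
have r2 : 0 < r / 2 by lra.
have mK : measurable (K : set (Borel R d)) by exact: borel_closed.
have mt s : measurable (thick K s : set (Borel R d)) by apply: borel_open; exact: open_thick.
pose v := w / 2 * (r / 2).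
have v0 : 0 < v by rewrite mulr_gt0//; lra.
have k01 : 0 < k < 1 by rewrite k0.
have [l lv] := geometric_lt (d%:R * C) k01 v0.
have W1v : (W1 (mu_ l) M < v%:E)%E by apply: (le_lt_trans (W1M l)); rewrite lte_fin.
have W1v1 : (W1 (mu_ l.+1) M < v%:E)%E.
  apply: (le_lt_trans (W1M l.+1)); rewrite lte_fin (le_lt_trans _ lv)//.
  rewrite exprS mulrCA ler_piMl ?(ltW k1)// mulr_ge0 ?exprn_ge0 ?(ltW k0)//.
  by rewrite mulr_ge0// divr_ge0// ltW.
have W1Psi : (W1 (mu_ l.+1) (PsiA M) < v%:E)%E.
  apply: (le_lt_trans (W1_Psi (pmu l) pM)); apply: le_lt_trans W1v.
  rewrite -[leRHS]mul1e lee_wpmul2r ?W1_ge0// lee_fin; lra.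
have [_] := W1_thick W1Psi mK r2.
have [+ _] := W1_thick W1v1 (mt (r / 2)) r2.
have -> : v / (r / 2) = w / 2 by rewrite /v mulfK// gt_eqF.
rewrite -(NE _ mK) => h1 h2; apply: (le_trans h2).
apply: (@le_trans _ _ (M (thick (thick K (r / 2)) (r / 2)) + (w / 2)%:E + (w / 2)%:E)%E).
  by rewrite leeD2r.
rewrite -addeA -EFinD -splitr leeD2r//.
apply: le_measure; rewrite ?inE//; first by apply: borel_open; exact: open_thick.
by move=> x /thick_thick; rewrite -splitr.
Qed.

(** [M] may be replaced by [PsiA M] inside [W1], which sees only Borel sets, so each application of
    [PsiA] shrinks the distance to [M]. At another fixed point this finite distance is at most [k]
    times itself, hence 0. *)
Lemma Psi_contraction (k : R) : k < 1 -> opnorm A + 2 * delta * sigma <= k ->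
  forall M, P1 M -> meq (PsiA M) M ->
  [/\ forall nu, P1 nu -> meq (PsiA nu) nu -> meq nu M &
      forall nu n, P1 nu -> (W1 (iter n PsiA nu) M <= (k ^+ n)%:E * W1 nu M)%E].
Proof.
move=> k1 kappa_k M pM fM.
have k0 : 0 <= k.
  rewrite (le_trans _ kappa_k)// addr_ge0 ?opnorm_ge0// !mulr_ge0 ?sigma_ge0//.
  exact: ltW.
have W1k nu : P1 nu -> (W1 (PsiA nu) M <= k%:E * W1 nu M)%E.
  move=> pnu; rewrite -(W1_meq (mu := PsiA nu) (fun B _ => erefl) fM).
  apply: (le_trans (W1_Psi pnu pM)).
  by rewrite lee_wpmul2r ?W1_ge0// lee_fin.
split.
  move=> nu pnu fnu; apply: W1_eq0 => //.
  have := W1k nu pnu; rewrite (W1_meq fnu (nu' := M))//.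
  have := W1_ge0 nu M; rewrite -(fineK (W1_fin pnu pM)) -EFinM !lee_fin => w0 wk.
  by congr EFin; apply/eqP; rewrite eq_le w0 andbT; nra.
move=> nu n pnu; elim: n => [|n ih]; first by rewrite expr0 mul1e.
apply: (le_trans (W1k _ (P1_iter_Psi n pnu))).
by rewrite exprS EFinM -muleA lee_wpmul2l ?lee_fin.
Qed.

End transition.

Theorem theorem3p3 (R : realType) (d m : nat) (hd : (0 < d)%N) (hm : (0 < m)%N)
  (A : 'M[R]_d) (delta : R) (theta : probability (Borel R m) R)
  (f : 'M[R]_(d,1) -> (set (Borel R d) -> \bar R) -> 'M[R]_(m,1) -> 'M[R]_(d,1))
  (omega : R)
  (* f is measurable (in (x, eps), for every fixed mu in P_1) *)
  (hf : forall mu : set (Borel R d) -> \bar R, P1 mu ->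
     measurable_fun [set: (Borel R d * Borel R m)%type]
       (fun p : (Borel R d * Borel R m)%type => (f p.1 mu p.2 : Borel R d)))
  (* (A1): sigma := \int D dtheta < oo *)
  (hD : measurable_fun [set: Borel R m] (Dlip f : Borel R m -> \bar R))
  (hA1 : (\int[theta]_z Dlip f z < +oo)%E)
  (* (A2) *)
  (hA2 : (\int[theta]_z (enorm (f 0 (@dirac _ (Borel R d) (0 : 'M[R]_(d,1)) R) z))%:E
            < +oo)%E)
  (* (A3) *)
  (homega : 0 < omega) (hA3 : opnorm A <= expR (- omega))
  (* delta in (0, a0), a0 = (1 - e^{-omega}) / (2 sigma) *)
  (hdelta0 : 0 < delta)
  (hdelta1 : ((2 * delta)%:E * (\int[theta]_z Dlip f z) < (1 - expR (- omega))%:E)%E) :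
  exists mu_inf : set (Borel R d) -> \bar R,
    [/\ P1 mu_inf,
        meq (Psi A delta f theta mu_inf) mu_inf,
        (forall nu, P1 nu -> meq (Psi A delta f theta nu) nu -> meq nu mu_inf) &
        (forall gamma, P1 gamma ->
           (limn_esup (fun n : nat =>
              (n%:R^-1)%:E * lne (W1 (iter n (Psi A delta f theta) gamma) mu_inf))
            < 0)%E)].
Proof.
set sigma := fine (\int[theta]_z Dlip f z)%E.
have sE : (\int[theta]_z Dlip f z = sigma%:E)%E.
  by rewrite fineK// ge0_fin_numE// integral_ge0// => z _; exact: Dlip_ge0.
(* Using [expR (- omega)] instead of [opnorm A] keeps [k] positive, so that [ln k] makes sense even
   for [A = 0]; [k < 1] is the bound on [delta] with its denominator cleared. *)
pose k := expR (- omega) + 2 * delta * sigma.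
have s0 : 0 <= 2 * delta * sigma.
  by rewrite mulr_ge0 ?(sigma_ge0 theta f)// mulr_ge0// ltW.
have e0 := expR_gt0 (- omega).
have k01 : 0 < k < 1.
  by move: hdelta1; rewrite sE -EFinM lte_fin /k => h; apply/andP; split; lra.
have kk : opnorm A + 2 * delta * sigma <= k by rewrite lerD2r.
have [mu pmu fmu] := Psi_fixpoint hf hD hA1 hA2 hdelta0 k01 kk.
have [_ k1] := andP k01.
have [uniq rate] := Psi_contraction hf hD hA1 hA2 hdelta0 k1 kk pmu fmu.
exists mu; split => // gamma pg.
apply: (limn_esup_lne_lt0 (c := fine (W1 gamma mu)) k01) => n.
by rewrite W1_ge0 mulrC EFinM fineK ?W1_fin// rate.
Qed.
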